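(* Let $k$ be a field and $n\geq 1$ an integer. Let $\Lambda_n$ be the $k$-algebra given by the quiver with vertices $0,1,\dots,n$ and, for each $0\leq i\leq n-1$, exactly $n+1$ arrows $x_0,\dots,x_n$ from vertex $i$ to vertex $i+1$ (the same symbols being used for the arrows between each pair of consecutive vertices), modulo all relations $x_ix_j=x_jx_i$ $(0\leq i,j\leq n)$ between paths of length two. If $M$ is a finitely generated $\Lambda_n$-module which generates the category of finitely generated $\Lambda_n$-modules, then $\operatorname{gl.dim}\operatorname{End}_{\Lambda_n}(M)\geq n$. In particular, the representation dimension satisfies $\operatorname{rep.dim}\Lambda_n\geq n$.
   Context: Modules are right modules; $\operatorname{mod}\Lambda$ denotes the category of finitely generated $\Lambda$-modules. A module $M\in\operatorname{mod}\Lambda$ generates $\operatorname{mod}\Lambda$ if every $X\in\operatorname{mod}\Lambda$ is a quotient of a finite direct sum of copies of $M$; it cogenerates $\operatorname{mod}\Lambda$ if every $X\in\operatorname{mod}\Lambda$ embeds into a finite direct sum of copies of $M$. For an artin algebra $\Lambda$, Auslander's representation dimension is $$\operatorname{rep.dim}\Lambda=\min\{\operatorname{gl.dim}\operatorname{End}_\Lambda(M)\mid M\in\operatorname{mod}\Lambda \text{ generates and cogenerates }\operatorname{mod}\Lambda\}.$$ $\operatorname{gl.dim}$ denotes global dimension (possibly $\infty$). *)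

(* Defs.v *)
From HB Require Import structures.
From mathcomp Require Import all_boot all_algebra.
From mathcomp Require Import finmap boolp.
From mathcomp Require Import monalg.

Set Implicit Arguments.
Unset Strict Implicit.
Unset Printing Implicit Defensive.

Import GRing.Theory.
Local Open Scope ring_scope.
Local Open Scope quotient_scope.

Variant enat := Fin of nat | Infty.

Definition le_enat (x y : enat) : bool :=
  match x, y with
  | _, Infty => true
  | Infty, Fin _ => false
  | Fin m, Fin n => (m <= n)%N
  end.

(* The minimum of P in N u {oo}; it is oo when P holds nowhere. *)
Definition enat_min (P : nat -> Prop) : enat :=
  if pselect (exists n, `[< P n >]) is left exP then Fin (ex_minn exP)
  else Infty.

Lemma enat_minP (P : nat -> Prop) (n : nat) :
  le_enat (Fin n) (enat_min P) <-> (forall d, P d -> (n <= d)%N).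
Proof.
rewrite /enat_min; case: pselect => [exP|noP] /=; last first.
  by split=> // _ d Pd; case: noP; exists d; apply/asboolP.
case: ex_minnP => m /asboolP Pm minP; split=> [nm d Pd|]; last exact.
by apply: leq_trans nm _; apply: minP; apply/asboolP.
Qed.

(* Right A-modules are left modules over the converse ring A^c. *)
Notation rmodType A := (lmodType A^c).

Section Modules.
Variable A : pzRingType.
Implicit Types M X Y P : rmodType A.

Definition surjective (U V : Type) (f : U -> V) := forall v, exists u, f u = v.

Definition fin_gen X :=
  exists (m : nat) (g : 'I_m -> X),
    forall x : X, exists a : 'I_m -> A^c, x = \sum_i a i *: g i.

Definition generates M :=
  forall X, fin_gen X ->
    exists (m : nat) (f : {linear {ffun 'I_m -> M} -> X}), surjective f.

Definition cogenerates M :=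
  forall X, fin_gen X ->
    exists (m : nat) (f : {linear X -> {ffun 'I_m -> M}}), injective f.

Definition projective P :=
  forall X Y (g : {linear X -> Y}) (f : {linear P -> Y}),
    surjective g -> exists h : {linear P -> X}, forall p, g (h p) = f p.

Definition exact (U V W : rmodType A) (f : {linear U -> V})
    (g : {linear V -> W}) :=
  forall v, g v = 0 <-> exists u, f u = v.

(* X has a projective resolution 0 -> P_d -> ... -> P_1 -> P_0 -> X -> 0,
   written as an infinite one with P_i = 0 for i > d. *)
Definition pdim_le X (d : nat) :=
  exists (P : nat -> rmodType A) (delta : forall i, {linear P i.+1 -> P i})
         (epsilon : {linear P 0%N -> X}),
    [/\ forall i, projective (P i),
        surjective epsilon,
        exact (delta 0%N) epsilon,
        forall i, exact (delta i.+1) (delta i)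
      & forall i, (d < i)%N -> forall x : P i, x = 0].

Definition pdim X : enat := enat_min (pdim_le X).

End Modules.

(* Right global dimension, over all right modules; the least finite bound on
   the projective dimensions is their supremum in N u {oo}. *)
Definition gldim (A : pzRingType) : enat :=
  enat_min (fun d => forall X : rmodType A, le_enat (pdim X) (Fin d)).

Section EndRing.
Variables (A : pzRingType) (M : rmodType A).

(* The product is composition, (f * g) x = f (g x). *)
Definition end_ring : Type := {linear M -> M}.

HB.instance Definition _ := gen_eqMixin end_ring.
HB.instance Definition _ := gen_choiceMixin end_ring.

Implicit Types f g h : end_ring.

Lemma end_ringP f g : (forall x, f x = g x) -> f = g.
Proof.
case: f g => [f [[f1] [f2]]] [g [[g1] [g2]]] /= /funext fg.
by case: g / fg g1 g2 => g1 g2; do !congr GRing.Linear.Pack;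
  congr GRing.Linear.Class; congr (_ _); apply: Prop_irrelevance.
Qed.

Definition end_zero : end_ring := (\0 : M -> M).
Definition end_opp f : end_ring := (\- f : M -> M).
Definition end_add f g : end_ring := (f \+ g : M -> M).
Definition end_one : end_ring := (idfun : M -> M).
Definition end_mul f g : end_ring := (f \o g : M -> M).

Lemma end_addA : associative end_add.
Proof. by move=> f g h; apply: end_ringP => x /=; rewrite addrA. Qed.

Lemma end_addC : commutative end_add.
Proof. by move=> f g; apply: end_ringP => x /=; rewrite addrC. Qed.

Lemma end_add0 : left_id end_zero end_add.
Proof. by move=> f; apply: end_ringP => x /=; rewrite add0r. Qed.

Lemma end_addN : left_inverse end_zero end_opp end_add.
Proof. by move=> f; apply: end_ringP => x /=; rewrite addNr. Qed.

HB.instance Definition _ :=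
  GRing.isZmodule.Build end_ring end_addA end_addC end_add0 end_addN.

Lemma end_mulA : associative end_mul.
Proof. by move=> f g h; apply: end_ringP. Qed.

Lemma end_mul1l : left_id end_one end_mul.
Proof. by move=> f; apply: end_ringP. Qed.

Lemma end_mul1r : right_id end_one end_mul.
Proof. by move=> f; apply: end_ringP. Qed.

Lemma end_mulDl : left_distributive end_mul +%R.
Proof. by move=> f g h; apply: end_ringP. Qed.

Lemma end_mulDr : right_distributive end_mul +%R.
Proof. by move=> f g h; apply: end_ringP => x /=; rewrite linearD. Qed.

HB.instance Definition _ := GRing.Zmodule_isPzRing.Build end_ring
  end_mulA end_mul1l end_mul1r end_mulDl end_mulDr.

End EndRing.

(* Meant for artin algebras; oo when every gl.dim End_A(M) is infinite. *)
Definition repdim (A : pzRingType) : enat :=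
  enat_min (fun d => exists M : rmodType A,
    [/\ fin_gen M, generates M, cogenerates M & gldim (end_ring M) = Fin d]).

Record quiver := Quiver {
  vertex : finType;
  arrow : finType;
  src : arrow -> vertex;
  tgt : arrow -> vertex
}.

Fixpoint walk (Q : quiver) (v : vertex Q) (s : seq (arrow Q)) : bool :=
  if s is a :: s' then (src a == v) && walk (tgt a) s' else true.

(* A path is its source together with its consecutive arrows, so that there is
   one trivial path at each vertex. *)
Record qpath (Q : quiver) := QPath {
  qpath_val : vertex Q * seq (arrow Q);
  _ : walk qpath_val.1 qpath_val.2
}.

HB.instance Definition _ (Q : quiver) := [isSub for @qpath_val Q].
HB.instance Definition _ (Q : quiver) := [Choice of qpath Q by <:].

Section Paths.
Variable Q : quiver.
Implicit Types p q r : qpath Q.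

Definition psrc p : vertex Q := (val p).1.
Definition parrows p : seq (arrow Q) := (val p).2.
Definition ptgt p : vertex Q := last (psrc p) (map (@tgt Q) (parrows p)).

Definition triv_path (v : vertex Q) : qpath Q := @QPath Q (v, [::]) isT.

Lemma arrow_path_subproof (a : arrow Q) : walk (src a) [:: a].
Proof. by rewrite /= eqxx. Qed.

Definition arrow_path (a : arrow Q) : qpath Q :=
  @QPath Q (src a, [:: a]) (arrow_path_subproof a).

(* First p, then q. *)
Definition pcat p q : option (qpath Q) :=
  if ptgt p == psrc q then insub (psrc p, parrows p ++ parrows q) else None.

Lemma walk_cat (v : vertex Q) s t :
  walk v (s ++ t) = walk v s && walk (last v (map (@tgt Q) s)) t.
Proof. by elim: s v => //= a s IHs v; rewrite IHs andbA. Qed.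

Lemma qpathP p q : psrc p = psrc q -> parrows p = parrows q -> p = q.
Proof.
move=> e1 e2; apply: val_inj.
by rewrite (surjective_pairing (val p)) (surjective_pairing (val q)); congr pair.
Qed.

Variant pcat_spec p q : option (qpath Q) -> Type :=
| PcatSome r of ptgt p = psrc q & psrc r = psrc p & ptgt r = ptgt q
    & parrows r = parrows p ++ parrows q : pcat_spec p q (Some r)
| PcatNone of ptgt p != psrc q : pcat_spec p q None.

Lemma pcatP p q : pcat_spec p q (pcat p q).
Proof.
rewrite /pcat; case: eqVneq => [epq|npq]; last by constructor.
case: insubP => [r _ er|]; last first.
  rewrite /= walk_cat; case: p epq => -[v s] /= sP; rewrite /ptgt /psrc /= sP.
  by case: q => -[w t] /= tP ->; rewrite tP.
constructor; rewrite /ptgt /psrc /parrows ?er //=.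
by rewrite map_cat last_cat -/(psrc p) -/(parrows p) -/(ptgt p) epq.
Qed.

Lemma pcatA p q r :
  obind (pcat p) (pcat q r) = obind (fun s => pcat s r) (pcat p q).
Proof.
case: (pcatP q r) => [u e1 e2 e3 e4|n1]; case: (pcatP p q) => [w f1 f2 f3 f4|n2] //=.
- case: (pcatP p u) => [x g1 g2 g3 g4|]; last by rewrite f1 e2 eqxx.
  case: (pcatP w r) => [y h1 h2 h3 h4|]; last by rewrite f3 e1 eqxx.
  by congr Some; apply: qpathP; rewrite ?g2 ?h2 ?f2 // g4 h4 e4 f4 catA.
- by case: (pcatP p u) => // x g1; rewrite g1 e2 eqxx in n2.
- by case: (pcatP w r) => // y h1; rewrite -f3 h1 eqxx in n1.
Qed.

Lemma pcat1p v p : pcat (triv_path v) p = if psrc p == v then Some p else None.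
Proof.
case: pcatP => [r|] /=; rewrite -[ptgt (triv_path v)]/v.
  by move=> e0 e1 _ e2; rewrite -e0 eqxx; congr Some; apply: qpathP; rewrite -?e0.
by rewrite eq_sym => /negbTE ->.
Qed.

Lemma pcatp1 v p : pcat p (triv_path v) = if ptgt p == v then Some p else None.
Proof.
case: pcatP => [r|] /=; rewrite -[psrc (triv_path v)]/v.
  by move=> -> e1 _ e2; rewrite eqxx; congr Some; apply: qpathP; rewrite ?e2 ?cats0.
by move=> /negbTE ->.
Qed.

Lemma pcat_eq_triv v p q :
  (pcat p q == Some (triv_path v)) = (p == triv_path v) && (q == triv_path v).
Proof.
apply/eqP/andP => [|[/eqP-> /eqP->]]; last by rewrite pcat1p eqxx.
case: pcatP => // r e1 e2 e3 e4 [er]; subst r.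
have: parrows p ++ parrows q = [::] by [].
case Ep: (parrows p) => //= Eq.
have sp: psrc p = v by [].
have tp: ptgt p = v by rewrite /ptgt Ep.
by split; apply/eqP/qpathP; rewrite // -e1.
Qed.

End Paths.

Definition path_alg (k : fieldType) (Q : quiver) : Type := {malg k[qpath Q]}.

HB.instance Definition _ (k : fieldType) (Q : quiver) :=
  GRing.Lmodule.on (path_alg k Q).

(* Locked, as unification otherwise unfolds the basis elements. *)
HB.lock Definition of_path (k : fieldType) (Q : quiver) (p : qpath Q) :
    path_alg k Q :=
  << p >>.
Canonical of_path_unlockable := Unlockable of_path.unlock.

Definition pmul (k : fieldType) (Q : quiver) (p q : qpath Q) : path_alg k Q :=
  if pcat p q is Some r then of_path k r else 0.

Definition path_one (k : fieldType) (Q : quiver) : path_alg k Q :=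
  \sum_v of_path k (triv_path v).

HB.lock Definition path_mul (k : fieldType) (Q : quiver) (f g : path_alg k Q) :
    path_alg k Q :=
  \sum_(p <- msupp f) \sum_(q <- msupp g) (f@_p * g@_q) *: pmul k p q.
Canonical path_mul_unlockable := Unlockable path_mul.unlock.

Section PathAlgebraRing.
Variables (k : fieldType) (Q : quiver).

Local Notation path_alg := (path_alg k Q).
Local Notation of_path := (@of_path k Q).
Local Notation pmul := (@pmul k Q).
Local Notation path_one := (@path_one k Q).
Local Notation path_mul := (@path_mul k Q).

Implicit Types f g h : path_alg.

Lemma path_mulw (d1 d2 : {fset qpath Q}) f g :
  (msupp f `<=` d1)%fset -> (msupp g `<=` d2)%fset ->
  path_mul f g = \sum_(p <- d1) \sum_(q <- d2) (f@_p * g@_q) *: pmul p q.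
Proof.
move=> le1 le2; rewrite path_mul.unlock (big_fset_incl _ le1) /=; last first.
  by move=> p _ /mcoeff_outdom fp; apply: big1 => q _; rewrite fp mul0r scale0r.
apply: eq_bigr => p _; apply: big_fset_incl => // q _ /mcoeff_outdom gq.
by rewrite gq mulr0 scale0r.
Qed.

Lemma path_mulDl : left_distributive path_mul +%R.
Proof.
move=> f g h; pose d := (msupp f `|` msupp g)%fset.
rewrite (@path_mulw d (msupp h) (f + g)) ?msuppD_le //.
rewrite (@path_mulw d (msupp h) f) ?fsubsetUl //.
rewrite (@path_mulw d (msupp h) g) ?fsubsetUr // -big_split /=.
apply: eq_bigr => p _; rewrite -big_split /=; apply: eq_bigr => q _.
by rewrite mcoeffD mulrDl scalerDl.
Qed.

Lemma path_mulDr : right_distributive path_mul +%R.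
Proof.
move=> h f g; pose d := (msupp f `|` msupp g)%fset.
rewrite (@path_mulw (msupp h) d h (f + g)) ?msuppD_le //.
rewrite (@path_mulw (msupp h) d h f) ?fsubsetUl //.
rewrite (@path_mulw (msupp h) d h g) ?fsubsetUr // -big_split /=.
apply: eq_bigr => p _; rewrite -big_split /=; apply: eq_bigr => q _.
by rewrite mcoeffD mulrDr scalerDl.
Qed.

Lemma path_mulZl c f g : path_mul (c *: f) g = c *: path_mul f g.
Proof.
rewrite (@path_mulw (msupp f) (msupp g) (c *: f)) ?msuppZ_le //.
rewrite path_mul.unlock scaler_sumr; apply: eq_bigr => p _.
by rewrite scaler_sumr; apply: eq_bigr => q _; rewrite mcoeffZ scalerA mulrA.
Qed.

Lemma path_mulZr c f g : path_mul f (c *: g) = c *: path_mul f g.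
Proof.
rewrite (@path_mulw (msupp f) (msupp g) f (c *: g)) ?msuppZ_le //.
rewrite path_mul.unlock scaler_sumr; apply: eq_bigr => p _.
rewrite scaler_sumr; apply: eq_bigr => q _.
by rewrite mcoeffZ scalerA mulrCA.
Qed.

Lemma path_mul0l : left_zero 0 path_mul.
Proof. by move=> f; rewrite path_mul.unlock msupp0 big_seq_fset0. Qed.

Lemma path_mul0r : right_zero 0 path_mul.
Proof.
by move=> f; rewrite path_mul.unlock; apply: big1 => p _; rewrite msupp0 big_seq_fset0.
Qed.

Lemma mcoeff_of_path p q : (of_path p)@_q = (p == q)%:R.
Proof. by rewrite of_path.unlock mcoeffU. Qed.

Lemma path_mulUU p q : path_mul (of_path p) (of_path q) = pmul p q.
Proof.
rewrite of_path.unlock (path_mulw msuppU_le msuppU_le) !big_seq_fset1.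
by rewrite !mcoeffUU mulr1 scale1r.
Qed.

Lemma of_pathE f : f = \sum_(p <- msupp f) f@_p *: of_path p.
Proof.
rewrite [LHS]monalgE; apply: eq_bigr => p _; apply/malgP => q.
by rewrite of_path.unlock [RHS]mcoeffZ [LHS]mcoeffU [X in _ * X]mcoeffU mulrnAr mulr1.
Qed.

Definition is_lin (V : lmodType k) (F : path_alg -> V) :=
  forall c f g, F (c *: f + g) = c *: F f + F g.

Lemma is_lin_ext (V : lmodType k) (F G : path_alg -> V) :
  is_lin F -> is_lin G -> (forall p, F (of_path p) = G (of_path p)) ->
  forall f, F f = G f.
Proof.
move=> linF linG eqFG f; rewrite (of_pathE f).
have lin0 (H : path_alg -> V) : is_lin H -> H 0 = 0.
  move=> linH; have := linH (- 1) 0 0; rewrite scaler0 addr0 => e.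
  by rewrite e scaleN1r addNr.
elim: (enum_fset (msupp f)) => [|p s IHs]; first by rewrite !big_nil !lin0.
by rewrite !big_cons linF linG eqFG IHs.
Qed.

Lemma path_mul_linl g : is_lin (path_mul^~ g).
Proof. by move=> c f f'; rewrite path_mulDl path_mulZl. Qed.

Lemma path_mul_linr f : is_lin (path_mul f).
Proof. by move=> c g g'; rewrite path_mulDr path_mulZr. Qed.

Lemma path_mulA : associative path_mul.
Proof.
move=> f g h; apply: (is_lin_ext (F := fun f => path_mul f (path_mul g h))
                                 (G := fun f => path_mul (path_mul f g) h)).
- exact: path_mul_linl.
- by move=> c x y; rewrite path_mul_linl path_mul_linl.
move=> p; apply: (is_lin_ext (F := fun g => path_mul (of_path p) (path_mul g h))
                      (G := fun g => path_mul (path_mul (of_path p) g) h)).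
- by move=> c x y; rewrite path_mul_linl path_mul_linr.
- by move=> c x y; rewrite path_mul_linr path_mul_linl.
move=> q; apply: (is_lin_ext
    (F := fun h => path_mul (of_path p) (path_mul (of_path q) h))
    (G := fun h => path_mul (path_mul (of_path p) (of_path q)) h)).
- by move=> c x y; rewrite !path_mul_linr.
- exact: path_mul_linr.
move=> r; rewrite !path_mulUU; have := pcatA p q r; rewrite /pmul.
case: (pcat q r) => [u|]; case: (pcat p q) => [w|] //=;
  rewrite ?path_mul0l ?path_mul0r ?path_mulUU /pmul.
- by move=> ->.
- by move=> ->.
- by move=> <-.
- by [].
Qed.

Lemma path_mul1l : left_id path_one path_mul.
Proof.
apply: is_lin_ext => [||p]; [exact: path_mul_linr | by [] |].
rewrite /path_one (big_morph (path_mul^~ _) (fun f g => path_mulDl f g _)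
                             (path_mul0l _)).
rewrite (bigD1 (psrc p)) //= path_mulUU /pmul pcat1p eqxx.
rewrite big1 ?addr0 // => v /negbTE nv.
by rewrite path_mulUU /pmul pcat1p eq_sym nv.
Qed.

Lemma path_mul1r : right_id path_one path_mul.
Proof.
apply: is_lin_ext => [||p]; [exact: path_mul_linl | by [] |].
rewrite /path_one (big_morph (path_mul _) (fun f g => path_mulDr _ f g)
                             (path_mul0r _)).
rewrite (bigD1 (ptgt p)) //= path_mulUU /pmul pcatp1 eqxx.
rewrite big1 ?addr0 // => v /negbTE nv.
by rewrite path_mulUU /pmul pcatp1 eq_sym nv.
Qed.

HB.instance Definition _ := GRing.Zmodule_isPzRing.Build path_alg
  path_mulA path_mul1l path_mul1r path_mulDl path_mulDr.

Lemma path_alg_scaleAl c f g : c *: (f * g) = (c *: f) * g.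
Proof. exact/esym/path_mulZl. Qed.

Lemma path_alg_scaleAr c f g : c *: (f * g) = f * (c *: g).
Proof. exact/esym/path_mulZr. Qed.

Lemma mcoeff_triv1 v : (1 : path_alg)@_(triv_path v) = 1.
Proof.
rewrite raddf_sum (bigD1 v) //= mcoeff_of_path eqxx big1 ?addr0 // => w nwv.
rewrite mcoeff_of_path; case: eqP => // /(congr1 (@psrc Q)) e.
by rewrite -[w]/(psrc (triv_path w)) e eqxx in nwv.
Qed.

Lemma mcoeff_trivM v f g :
  (f * g)@_(triv_path v) = f@_(triv_path v) * g@_(triv_path v).
Proof.
have linM (c : k) (x y z : path_alg) :
    (c *: x + y) * z = c *: (x * z) + y * z.
  exact: path_mul_linl.
have linMr (c : k) (x y z : path_alg) :
    z * (c *: x + y) = c *: (z * x) + z * y.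
  exact: path_mul_linr.
have linC c x y : (c *: x + y : path_alg)@_(triv_path v) =
    c * x@_(triv_path v) + y@_(triv_path v).
  by rewrite mcoeffD mcoeffZ.
apply: (@is_lin_ext k^o (fun f => (f * g)@_(triv_path v))
          (fun f => f@_(triv_path v) * g@_(triv_path v))) => [c x y|c x y|p].
- by rewrite linM linC.
- by rewrite linC mulrDl -mulrA.
apply: (@is_lin_ext k^o (fun g => (of_path p * g)@_(triv_path v))
  (fun g => (of_path p)@_(triv_path v) * g@_(triv_path v))) => [c x y|c x y|q].
- by rewrite linMr linC.
- by rewrite linC mulrDr mulrCA.
rewrite [of_path p * _]path_mulUU /pmul !mcoeff_of_path.
have := pcat_eq_triv v p q; case: (pcat p q) => [r|] /=.
  by rewrite (inj_eq Some_inj) mcoeff_of_path -natrM mulnb => ->.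
by rewrite mcoeff0 -natrM mulnb => <-.
Qed.

End PathAlgebraRing.

Definition arrow_elt (k : fieldType) (Q : quiver) (a : arrow Q) : path_alg k Q :=
  of_path k (arrow_path a).

Section Ideals.
Variable R : pzRingType.

Definition two_sided_ideal (J : R -> Prop) :=
  [/\ J 0, forall x y, J x -> J y -> J (x - y),
      forall a x, J x -> J (a * x) & forall a x, J x -> J (x * a)].

Variable S : R -> Prop.

Definition ideal_gen : {pred R} := fun x =>
  `[< forall J, two_sided_ideal J -> (forall y, S y -> J y) -> J x >].

Lemma ideal_genP : two_sided_ideal (fun x => x \in ideal_gen).
Proof.
split=> [|x y /asboolP xI /asboolP yI|a x /asboolP xI|a x /asboolP xI];
  apply/asboolP => J JI SJ; case: (JI) => J0 JB Jl Jr.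
- exact: J0.
- by apply: JB; [apply: xI | apply: yI].
- by apply: Jl; apply: xI.
- by apply: Jr; apply: xI.
Qed.

Lemma mem_ideal_gen x : S x -> x \in ideal_gen.
Proof. by move=> Sx; apply/asboolP => J _; apply. Qed.

Lemma ideal_gen_zmod_closed : zmod_closed ideal_gen.
Proof. by have [I0 IB _ _] := ideal_genP; split. Qed.

HB.instance Definition _ :=
  GRing.isZmodClosed.Build R ideal_gen ideal_gen_zmod_closed.

Definition quot_ring : Type := Quotient.quot ideal_gen.

HB.instance Definition _ := GRing.Zmodule.on quot_ring.

Definition quot_pi (x : R) : quot_ring := \pi_(Quotient.quot ideal_gen) x.
Definition quot_repr (x : quot_ring) : R := repr (x : Quotient.quot ideal_gen).

Lemma quot_reprK : cancel quot_repr quot_pi.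
Proof. exact: reprK. Qed.

Lemma quot_piP x y : quot_pi x = quot_pi y <-> x - y \in ideal_gen.
Proof. by rewrite Quotient.idealrBE; split => [/eqP|/eqP]. Qed.

Lemma quot_piD : {morph quot_pi : x y / x + y}.
Proof. by move=> x y; rewrite /quot_pi !piE. Qed.

Lemma quot_pi0 : quot_pi 0 = 0.
Proof. by apply: (addrI (quot_pi 0)); rewrite -quot_piD !addr0. Qed.

Lemma quot_pi_repr x : x - quot_repr (quot_pi x) \in ideal_gen.
Proof. by apply/quot_piP; rewrite quot_reprK. Qed.

Definition quot_one : quot_ring := quot_pi 1.
Definition quot_mul (x y : quot_ring) : quot_ring :=
  quot_pi (quot_repr x * quot_repr y).

Lemma quot_piM x y : quot_pi (x * y) = quot_mul (quot_pi x) (quot_pi y).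
Proof.
have [_ IB Il Ir] := ideal_genP; apply/quot_piP.
set x' := quot_repr _; set y' := quot_repr _.
rewrite -[x * y](subrK (x' * y)) -addrA -mulrBl -mulrBr.
by apply: rpredD; [apply: Ir | apply: Il]; apply: quot_pi_repr.
Qed.

Lemma quot_mulA : associative quot_mul.
Proof.
move=> x y z; rewrite -(quot_reprK x) -(quot_reprK y) -(quot_reprK z).
by rewrite -!quot_piM mulrA.
Qed.

Lemma quot_mul1l : left_id quot_one quot_mul.
Proof. by move=> x; rewrite -(quot_reprK x) -quot_piM mul1r. Qed.

Lemma quot_mul1r : right_id quot_one quot_mul.
Proof. by move=> x; rewrite -(quot_reprK x) -quot_piM mulr1. Qed.

Lemma quot_mulDl : left_distributive quot_mul +%R.
Proof.
move=> x y z; rewrite -(quot_reprK x) -(quot_reprK y) -(quot_reprK z).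
by rewrite -quot_piD -!quot_piM -quot_piD mulrDl.
Qed.

Lemma quot_mulDr : right_distributive quot_mul +%R.
Proof.
move=> x y z; rewrite -(quot_reprK x) -(quot_reprK y) -(quot_reprK z).
by rewrite -quot_piD -!quot_piM -quot_piD mulrDr.
Qed.

HB.instance Definition _ := GRing.Zmodule_isPzRing.Build quot_ring
  quot_mulA quot_mul1l quot_mul1r quot_mulDl quot_mulDr.

End Ideals.

Section Lambda.
Variables (k : fieldType) (n : nat).

(* The arrow (i, a) is x_a from vertex i to vertex i + 1. *)
Definition Lambda_quiver : quiver :=
  @Quiver 'I_n.+1 ('I_n * 'I_n.+1)%type
    (fun ia => widen_ord (leqnSn n) ia.1) (fun ia => lift ord0 ia.1).

Local Notation kQ := (path_alg k Lambda_quiver).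

Definition xarrow (a : 'I_n.+1) (i : 'I_n) : kQ :=
  @arrow_elt k Lambda_quiver (i, a).

Definition Lambda_rel (r : kQ) : Prop :=
  exists (i j : 'I_n) (a b : 'I_n.+1), (j = i.+1 :> nat) /\
    r = xarrow a i * xarrow b j - xarrow b i * xarrow a j.

Definition Lambda : Type := quot_ring Lambda_rel.

HB.instance Definition _ := GRing.PzRing.on Lambda.

Implicit Types x y : Lambda.

Lemma Lambda_one_neq0 : (1 : Lambda) != 0.
Proof.
apply/eqP; rewrite -[0]quot_pi0 => /quot_piP; rewrite subr0 => /asboolP.
pose J (f : kQ) := forall v, f@_(triv_path v) = 0.
move=> /(_ J) J1; suff /(_ ord0) : J 1.
  by rewrite mcoeff_triv1 => /eqP; rewrite oner_eq0.
apply: J1.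
  split=> [v|f g Jf Jg v|a f Jf v|a f Jf v].
  - by rewrite mcoeff0.
  - by rewrite mcoeffB Jf Jg subr0.
  - by rewrite mcoeff_trivM Jf mulr0.
  - by rewrite mcoeff_trivM Jf mul0r.
have Jx a i v : (xarrow a i)@_(triv_path v) = 0.
  by rewrite mcoeff_of_path; case: eqP => // _; rewrite mulr0n.
move=> _ [i [j [a [b [_ ->]]]]] v.
by rewrite mcoeffB !mcoeff_trivM !Jx !mul0r subr0.
Qed.

HB.instance Definition _ :=
  GRing.PzSemiRing_isNonZero.Build Lambda Lambda_one_neq0.

Definition Lambda_scale (c : k) (x : Lambda) : Lambda :=
  quot_pi _ (c *: quot_repr x).

Lemma ideal_genZ (c : k) (f : kQ) :
  f \in ideal_gen Lambda_rel -> c *: f \in ideal_gen Lambda_rel.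
Proof.
have [_ _ Il _] := ideal_genP Lambda_rel.
by move=> fI; rewrite -[f]mul1r path_alg_scaleAl; apply: Il.
Qed.

Lemma Lambda_piZ c (f : kQ) :
  quot_pi Lambda_rel (c *: f) = Lambda_scale c (quot_pi Lambda_rel f).
Proof.
apply/quot_piP; rewrite -scalerBr; apply: ideal_genZ; exact: quot_pi_repr.
Qed.

Lemma Lambda_scaleA c d x :
  Lambda_scale c (Lambda_scale d x) = Lambda_scale (c * d) x.
Proof. by rewrite -(quot_reprK x) -!Lambda_piZ scalerA. Qed.

Lemma Lambda_scale1 : left_id 1 Lambda_scale.
Proof. by move=> x; rewrite -(quot_reprK x) -Lambda_piZ scale1r. Qed.

Lemma Lambda_scaleDr : right_distributive Lambda_scale +%R.
Proof.
move=> c x y; rewrite -(quot_reprK x) -(quot_reprK y).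
by rewrite -quot_piD -!Lambda_piZ -quot_piD scalerDr.
Qed.

Lemma Lambda_scaleDl x : {morph Lambda_scale^~ x : c d / c + d}.
Proof.
by move=> c d; rewrite -(quot_reprK x) -!Lambda_piZ -quot_piD scalerDl.
Qed.

HB.instance Definition _ := GRing.Zmodule_isLmodule.Build k Lambda
  Lambda_scaleA Lambda_scale1 Lambda_scaleDr Lambda_scaleDl.

Definition Lambda_pi (f : kQ) : Lambda := quot_pi Lambda_rel f.

Lemma Lambda_pi_surj x : exists f, x = Lambda_pi f.
Proof. by exists (quot_repr x); rewrite /Lambda_pi quot_reprK. Qed.

Lemma Lambda_pi_scale c f : Lambda_pi (c *: f) = c *: Lambda_pi f.
Proof. exact: Lambda_piZ. Qed.

Lemma Lambda_pi_mul f g : Lambda_pi (f * g) = Lambda_pi f * Lambda_pi g.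
Proof. exact: quot_piM. Qed.

Lemma Lambda_scaleAl c x y : c *: (x * y) = (c *: x) * y.
Proof.
have [[f ->] [g ->]] := (Lambda_pi_surj x, Lambda_pi_surj y).
by rewrite -Lambda_pi_mul -!Lambda_pi_scale -Lambda_pi_mul path_alg_scaleAl.
Qed.

HB.instance Definition _ :=
  GRing.LSemiModule_isLSemiAlgebra.Build k Lambda Lambda_scaleAl.

Lemma Lambda_scaleAr c x y : c *: (x * y) = x * (c *: y).
Proof.
have [[f ->] [g ->]] := (Lambda_pi_surj x, Lambda_pi_surj y).
by rewrite -Lambda_pi_mul -!Lambda_pi_scale -Lambda_pi_mul path_alg_scaleAr.
Qed.

HB.instance Definition _ :=
  GRing.LSemiAlgebra_isSemiAlgebra.Build k Lambda Lambda_scaleAr.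

End Lambda.

(* Main.v *)
Require Import Defs.
From HB Require Import structures.
From mathcomp Require Import all_boot all_algebra.
From mathcomp Require Import finmap boolp.
From mathcomp Require Import mpoly.
From mathcomp Require monalg.

(** Read a module over the polynomial ring [A = k[x_1, .., x_n]] (the affine
    chart [x_0 = 1]) as a representation with the same space at every vertex.
    Let [C] be a finite-dimensional [A]-module supported at one point of the
    chart, and let the tangent module [C[eps]] in direction [i] deform the
    action of [x_i] by [eps].  The extensions
    [0 -> C -> C[eps] -> C -> 0], for [i = 1, .., n], have a Yoneda product in
    [Ext^n], which is nonzero: evaluated on a Koszul complex, its vanishing
    would write the identity of [C] as a sum of commutators, against the trace
    as soon as [dim C] is nonzero in [k].  If the point is chosen outside the
    locus where the relations of [M] drop rank, all these extensions remain
    exact under [Hom(M, -)], so each step of a projective resolution of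
    [Hom(M, C)] over [End M] can absorb only one factor of the product, and the
    projective dimension of [Hom(M, C)] is at least [n]. *)

Set Implicit Arguments.
Unset Strict Implicit.
Unset Printing Implicit Defensive.

Import GRing.Theory.
Local Open Scope ring_scope.

(** * Linear maps and Hom modules *)

Section LinearConstructions.
Variable R : pzRingType.

Definition mk_linear (U V : lmodType R) (f : U -> V)
    (fL : forall a u v, f (a *: u + v) = a *: f u + f v) : {linear U -> V} :=
  HB.pack f (GRing.isLinear.Build R U V *:%R f fL).

Lemma linear_ext (U V : lmodType R) (f g : {linear U -> V}) :
  (forall x, f x = g x) -> f = g.
Proof.
case: f g => [f [[f1] [f2]]] [g [[g1] [g2]]] /= /funext fg.
by case: g / fg g1 g2 => g1 g2; do !congr GRing.Linear.Pack;
  congr GRing.Linear.Class; congr (_ _); apply: Prop_irrelevance.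
Qed.

Lemma linear_factor (U V W : lmodType R) (i : {linear U -> V})
    (f : {linear W -> V}) :
  injective i -> (forall w, exists u, i u = f w) ->
  exists h : {linear W -> U}, forall w, i (h w) = f w.
Proof.
move=> injI fI; pose h w := projT1 (cid (fI w)).
have hE w : i (h w) = f w by rewrite /h; case: cid.
suff hL a u v : h (a *: u + v) = a *: h u + h v by exists (mk_linear hL).
by apply: injI; rewrite linearP !hE linearP.
Qed.

Lemma linear_of_gens (M Y : lmodType R) (q : nat) (g : 'I_q -> M)
    (y : 'I_q -> Y) :
  (forall x : M, exists a : 'I_q -> R, x = \sum_i a i *: g i) ->
  (forall a : 'I_q -> R, \sum_i a i *: g i = 0 -> \sum_i a i *: y i = 0) ->
  exists f : {linear M -> Y}, forall i, f (g i) = y i.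
Proof.
move=> genM relY; pose c x := projT1 (cid (genM x)).
have cE x : x = \sum_i c x i *: g i by rewrite /c; case: cid.
pose f x := \sum_i c x i *: y i.
have fE a : f (\sum_i a i *: g i) = \sum_i a i *: y i.
  apply/eqP; rewrite -subr_eq0 /f -sumrB; apply/eqP.
  under eq_bigr do rewrite -scalerBl; apply: relY.
  by under eq_bigr do rewrite scalerBl; rewrite sumrB -cE subrr.
have fL a u v : f (a *: u + v) = a *: f u + f v.
  rewrite {1}(cE u) {1}(cE v) scaler_sumr -big_split /=.
  under eq_bigr do rewrite scalerA -scalerDl.
  rewrite fE scaler_sumr -big_split /=; apply: eq_bigr => i _.
  by rewrite scalerDl scalerA.
exists (mk_linear fL) => i /=.
have -> : g i = \sum_j (j == i)%:R *: g j.
  rewrite (bigD1 i) //= eqxx scale1r big1 ?addr0 // => j /negbTE ->.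
  by rewrite scale0r.
rewrite fE (bigD1 i) //= eqxx scale1r big1 ?addr0 // => j /negbTE ->.
by rewrite scale0r.
Qed.

End LinearConstructions.

(** * The functor [Hom(M, -)] to right modules over [End M] *)

Section HomModule.
Variables (A : pzRingType) (M : rmodType A).

Definition hom_mod (Y : rmodType A) : Type := {linear M -> Y}.

HB.instance Definition _ Y := gen_eqMixin (hom_mod Y).
HB.instance Definition _ Y := gen_choiceMixin (hom_mod Y).

Section Structure.
Variable Y : rmodType A.
Implicit Types f g h : hom_mod Y.

Lemma hom_modP f g : (forall x, f x = g x) -> f = g.
Proof. exact: linear_ext. Qed.

Definition hom_zero : hom_mod Y := (\0 : M -> Y).
Definition hom_opp f : hom_mod Y := (\- f : M -> Y).
Definition hom_add f g : hom_mod Y := (f \+ g : M -> Y).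
(** Precomposition is a right action of [End M], hence a left action of the converse ring. *)
Definition hom_scale (e : (end_ring M)^c) f : hom_mod Y :=
  (f \o (e : {linear M -> M}) : M -> Y).

Lemma hom_addA : associative hom_add.
Proof. by move=> f g h; apply: hom_modP => x /=; rewrite addrA. Qed.

Lemma hom_addC : commutative hom_add.
Proof. by move=> f g; apply: hom_modP => x /=; rewrite addrC. Qed.

Lemma hom_add0 : left_id hom_zero hom_add.
Proof. by move=> f; apply: hom_modP => x /=; rewrite add0r. Qed.

Lemma hom_addN : left_inverse hom_zero hom_opp hom_add.
Proof. by move=> f; apply: hom_modP => x /=; rewrite addNr. Qed.

HB.instance Definition _ :=
  GRing.isZmodule.Build (hom_mod Y) hom_addA hom_addC hom_add0 hom_addN.

Lemma hom_scaleA a b f : hom_scale a (hom_scale b f) = hom_scale (a * b) f.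
Proof. exact: hom_modP. Qed.

Lemma hom_scale1 : left_id 1 hom_scale.
Proof. by move=> f; apply: hom_modP. Qed.

Lemma hom_scaleDr : right_distributive hom_scale +%R.
Proof. by move=> a f g; apply: hom_modP. Qed.

Lemma hom_scaleDl f : {morph hom_scale^~ f : a b / a + b}.
Proof. by move=> a b; apply: hom_modP => x /=; rewrite linearD. Qed.

HB.instance Definition _ := GRing.Zmodule_isLmodule.Build (end_ring M)^c
  (hom_mod Y) hom_scaleA hom_scale1 hom_scaleDr hom_scaleDl.

Lemma hom_sumE (I : finType) (F : I -> hom_mod Y) x :
  (\sum_i F i : hom_mod Y) x = \sum_i F i x.
Proof. by apply: (big_morph (fun f : hom_mod Y => f x)). Qed.

End Structure.

Section Functor.
Variables (Y Y' : rmodType A) (p : {linear Y -> Y'}).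

Definition hom_map_fun (f : hom_mod Y) : hom_mod Y' := (p \o f : M -> Y').

Lemma hom_map_is_linear (a : (end_ring M)^c) f g :
  hom_map_fun (a *: f + g) = a *: hom_map_fun f + hom_map_fun g.
Proof. by apply: hom_modP => x /=; rewrite linearD. Qed.

Definition hom_map : {linear hom_mod Y -> hom_mod Y'} :=
  mk_linear hom_map_is_linear.

Lemma hom_mapE f x : hom_map f x = p (f x).
Proof. by []. Qed.

End Functor.

End HomModule.

(** * Products of extensions against a projective resolution *)

Section GhostLemma.
Variables (G : pzRingType) (Z : rmodType G) (n : nat).
Variables (E : 'I_n -> rmodType G).
Variables (iota : forall i, {linear Z -> E i}) (pi : forall i, {linear E i -> Z}).
Hypothesis iota_inj : forall i, injective (iota i).
Hypothesis iota_pi : forall i, exact (iota i) (pi i).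
Hypothesis pi_surj : forall i, surjective (pi i).
Variables (r : finType) (D : r -> r -> G).

(** A family [y] is a map from the free module on [r] to [Y], that is, a cochain with values in [Y].
    With [D] the matrix of a differential on that free module, [mulD] is the coboundary. *)
Definition mulD (Y : rmodType G) (y : r -> Y) (j : r) : Y :=
  \sum_l (D l j : G^c) *: y l.

Lemma mulD_linear (Y Y' : rmodType G) (f : {linear Y -> Y'}) y j :
  f (mulD y j) = mulD (fun l => f (y l)) j.
Proof. by rewrite linear_sum; apply: eq_bigr => l _; rewrite linearZ. Qed.

Lemma mulDB (Y : rmodType G) (y z : r -> Y) j :
  mulD (fun l => y l - z l) j = mulD y j - mulD z j.
Proof. by rewrite -sumrB; apply: eq_bigr => l _; rewrite scalerBr. Qed.

Lemma eq_mulD (Y : rmodType G) (y z : r -> Y) :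
  (forall l, y l = z l) -> forall j, mulD y j = mulD z j.
Proof. by move=> yz j; apply: eq_bigr => l _; rewrite yz. Qed.

Lemma mulD0 (Y : rmodType G) j : mulD (fun=> 0 : Y) j = 0.
Proof. by rewrite /mulD big1 // => l _; rewrite scaler0. Qed.

Hypothesis D_sqr : forall l j, \sum_i D l i * D i j = 0.

Lemma mulDD (Y : rmodType G) (y : r -> Y) j : mulD (mulD y) j = 0.
Proof.
rewrite /mulD; under eq_bigr do rewrite scaler_sumr.
rewrite exchange_big big1 //= => l _.
under eq_bigr do rewrite scalerA.
rewrite -scaler_suml; set s := (X in X *: y l).
suff -> : s = 0 by rewrite scale0r.
exact: (D_sqr l j).
Qed.

(** The cochain [b i] lifts [c i], and its coboundary comes from [c i.+1]: the connecting map of the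
    [i]-th extension takes the class of [c i] to that of [c i.+1]. *)
Variables (c : nat -> r -> Z) (b : forall i, r -> E i).
Hypothesis pi_b : forall (i : 'I_n) j, pi i (b i j) = c i j.
Hypothesis b_D : forall (i : 'I_n) j, mulD (b i) j = iota i (c i.+1 j).

(* The classes [iota i, pi i] have a composite of degree [n], which [c n]
   represents on the complex [D]; below the [n]-th syzygy it must vanish. *)
Lemma pdim_ghost (d : nat) : (d < n)%N -> pdim_le Z d ->
  exists s : r -> Z, forall j, c n j = mulD s j.
Proof.
move=> ltdn [P [delta [eps [projP surj_eps exact0 exactS P0]]]].
have pi_iota i z : pi i (iota i z) = 0 by apply/iota_pi; exists z.
(* Invariant: up to the coboundary of [s], [c i] is the image of a cochain [a] of [P i] under a
   cocycle [g] of the resolution, and [a'] lifts the coboundary of [a]. At [i = n] the module [P n]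
   vanishes, so only the coboundary of [s] is left. *)
suff /(_ n (leqnn n)) [g [a [s [a' [_ _ cE]]]]] : forall i, (i <= n)%N ->
    exists (g : {linear P i -> Z}) (a : r -> P i) (s : r -> Z)
      (a' : r -> P i.+1),
    [/\ forall x, g (delta i x) = 0, forall j, delta i (a' j) = mulD a j
      & forall j, c i j = g (a j) + mulD s j].
  by exists s => j; rewrite cE (P0 n ltdn (a j)) linear0 add0r.
elim=> [_|i IHi lt_in].
  have n_gt0 : (0 < n)%N by apply: leq_trans ltdn.
  pose i0 : 'I_n := Ordinal n_gt0.
  have [a aE] := choice (fun j => surj_eps (c 0%N j)).
  have aD j : exists x, delta 0%N x = mulD a j.
    apply/exact0; rewrite mulD_linear (eq_mulD aE).
    by rewrite -(eq_mulD (pi_b i0)) -mulD_linear b_D pi_iota.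
  have [a' a'E] := choice aD.
  exists eps, a, (fun=> 0), a'; split=> // [x|j].
    by apply/exact0; exists x.
  by rewrite aE mulD0 addr0.
have [g [a [s [a' [gd da' cE]]]]] := IHi (ltnW lt_in).
pose i1 : 'I_n := Ordinal lt_in.
(* Projectivity of [P i] lifts [g] to the extension; restricted along [delta i], the lift lands in
   [Z]. This restriction [g'] is the connecting map applied to [g]. *)
have [gh ghE] := projP i _ _ (pi i1) g (@pi_surj i1).
have [g' g'E] : exists g' : {linear P i.+1 -> Z},
    forall x, iota i1 (g' x) = gh (delta i x).
  have ghd x : exists u, iota i1 u = (gh \o delta i) x.
    by apply/iota_pi; rewrite /= ghE gd.
  by have [g' g'E] := linear_factor (@iota_inj i1) ghd; exists g'.
have [sh shE] := choice (fun j => @pi_surj i1 (s j)).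
(* Both [b] and the lift of the invariant project to [c i], so they differ by a cochain [t] of [Z].
   Its coboundary is the new error term, since the coboundary of [mulD sh] is zero. *)
have tP j : exists u, iota i1 u = b i1 j - gh (a j) - mulD sh j.
  apply/iota_pi; rewrite !linearB /= pi_b ghE cE mulD_linear (eq_mulD shE).
  by rewrite [g _ + _]addrC addrK subrr.
have [t tE] := choice tP.
have aP j : exists x, delta i.+1 x = mulD a' j.
  by apply/exactS; rewrite mulD_linear (eq_mulD da') mulDD.
have [a'' a''E] := choice aP.
exists g', a', t, a''; split=> // [x|j].
  apply: (@iota_inj i1); rewrite g'E linear0.
  by have /exactS -> : exists u, delta i.+1 u = delta i.+1 x; [exists x|apply: linear0].
apply: (@iota_inj i1); rewrite linearD g'E da' !mulD_linear (eq_mulD tE).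
by rewrite !mulDB mulDD subr0 b_D addrC subrK.
Qed.

End GhostLemma.

(** * Generic rank of a family of relations *)

Section GenericKernel.
Local Open Scope quotient_scope.

Variable A : idomainType.

Lemma frac_denominator (x : {fraction A}) :
  exists2 d : A, d != 0 & exists y, tofrac d * x = tofrac y.
Proof.
elim/quotW: x => x; exists (\d_x); first exact: denom_ratioP.
exists (\n_x); rewrite -[tofrac _ * _]/(FracField.mul _ _) !piE; apply/eqmodP.
rewrite /= FracField.equivfE /FracField.mulf.
rewrite !numden_Ratio ?mulf_neq0 ?oner_neq0 ?denom_ratioP //.
by rewrite mul1r mulr1.
Qed.

Lemma mx_denominator (m p : nat) (X : 'M[{fraction A}]_(m, p)) :
  exists2 d : A, d != 0 & exists Y : 'M[A]_(m, p),
    tofrac d *: X = map_mx (@tofrac A) Y.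
Proof.
have dP (i : 'I_m * 'I_p) :
    exists dy : A * A, dy.1 != 0 /\ tofrac dy.1 * X i.1 i.2 = tofrac dy.2.
  by have [d d0 [y e]] := frac_denominator (X i.1 i.2); exists (d, y).
have {dP} [dy dyP] := choice dP.
exists (\prod_i (dy i).1); first by apply/prodf_neq0 => i _; case: (dyP i).
exists (\matrix_(i, j) ((\prod_(l | l != (i, j)) (dy l).1) * (dy (i, j)).2)).
apply/matrixP => i j; rewrite !mxE (bigD1 (i, j)) //= mulrC !rmorphM /=.
by rewrite mulrA [X i j * _]mulrC (dyP (i, j)).2 mulrC.
Qed.

(** Choose rows of [D] in [Rel] with the largest rank over the fraction field. Appending another [v]
    from [Rel] cannot raise the rank, so [v] lies in the row space of [D]. The coefficients come
    from a pseudo-inverse of [D], whose common denominator [f] serves every [v] at once. *)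
Lemma generic_kernel (N : nat) (Rel : 'rV[A]_N -> Prop) :
  exists2 f : A, f != 0 & exists (m : nat) (D : 'M[A]_(m, N)) (Psi : 'M[A]_(N, m)),
    (forall i, Rel (row i D)) /\ forall v, Rel v -> f *: v = v *m Psi *m D.
Proof.
pose fr m := map_mx (@tofrac A) : 'M_(m, N) -> 'M_(m, N).
pose P s := `[< exists m (D : 'M[A]_(m, N)),
  (forall i, Rel (row i D)) /\ \rank (fr _ D) = s >].
have P0 : exists s, P s.
  exists 0%N; apply/asboolP; exists 0%N, 0; split=> [[]//|].
  by rewrite [fr _ _]flatmx0 mxrank0.
have Pmax s : P s -> (s <= N)%N.
  by move=> /asboolP [m [D [_ <-]]]; apply: rank_leq_col.
case: (ex_maxnP P0 Pmax) => s /asboolP [m [D [RelD rkD]]] maxs.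
have subD v : Rel v -> (fr _ v <= fr _ D)%MS.
  move=> Rv; pose D' := col_mx v D.
  have frD' : fr _ D' = col_mx (fr _ v) (fr _ D) by rewrite /fr map_col_mx.
  have sDD' : (fr _ D <= fr _ D')%MS.
    by rewrite frD' -addsmxE addsmxSr.
  have : (\rank (fr _ D') <= s)%N.
    apply: maxs; apply/asboolP; exists (1 + m)%N, D'; split=> // i.
    rewrite -(splitK i); case: (split i) => j /=.
      by rewrite rowKu [row j v](_ : _ = v) //; apply/rowP => l; rewrite mxE ord1.
    by rewrite rowKd.
  rewrite -rkD => le; have := mxrank_leqif_sup sDD'.
  move=> /geq_leqif; rewrite le frD' col_mx_sub.
  by move=> /esym /andP [].
have [f f0 [Psi PsiE]] := mx_denominator (pinvmx (fr _ D)).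
exists f => //; exists m, D, Psi; split=> // v Rv.
suff : fr _ (f *: v) = fr _ (v *m Psi *m D).
  move=> e; apply/matrixP => i j; apply/eqP; rewrite -tofrac_eq; apply/eqP.
  by have /matrixP/(_ i j) := e; rewrite !mxE.
rewrite /fr map_mxZ !map_mxM -PsiE -scalemxAr -scalemxAl.
by rewrite -{1}[map_mx _ v](mulmxKpV (subD v Rv)).
Qed.

End GenericKernel.

(** * Points with invertible values *)

Lemma base_digits_inj (B n : nat) (a b : 'I_n -> nat) :
  (forall i, (a i < B)%N) -> (forall i, (b i < B)%N) ->
  (\sum_i a i * B ^ i = \sum_i b i * B ^ i)%N -> a =1 b.
Proof.
elim: n a b => [|n IHn] a b aB bB; first by move=> _ [].
rewrite !big_ord_recl /= expn0 !muln1.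
have split_sum (c : 'I_n.+1 -> nat) :
    (\sum_(i < n) c (lift ord0 i) * B ^ bump 0 i =
     (\sum_(i < n) c (lift ord0 i) * B ^ i) * B)%N.
  by rewrite big_distrl; apply: eq_bigr => i _; rewrite /bump add1n expnS mulnCA mulnC.
rewrite !split_sum => e.
have B0 : (0 < B)%N by apply: leq_ltn_trans (aB ord0).
have e0 : a ord0 = b ord0.
  have := congr1 (modn^~ B) e.
  by rewrite /= ![(_ + _ * B)%N]addnC !modnMDl !modn_small.
have /eqP := e; rewrite e0 eqn_add2l eqn_pmul2r // => /eqP eS i.
case: (unliftP ord0 i) => [j ->|-> //].
exact: (IHn (fun j => a (lift ord0 j)) (fun j => b (lift ord0 j))).
Qed.

Section MatrixPoint.
Variables (k : fieldType) (n : nat).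

(* Kronecker substitution. *)
Lemma mmap_neq0 (f : {mpoly k[n]}) : f != 0 ->
  exists q : 'I_n -> {poly k}, mmap polyC q f != 0.
Proof.
(* [B] exceeds every exponent occurring in [f], so distinct monomials go to distinct powers of ['X]
   and the leading coefficient survives. *)
move=> f0; pose B := msize f; exists (fun i => 'X^(B ^ i)).
pose w (m : 'X_{1..n}) := (\sum_i m i * B ^ i)%N.
have digit m i : m \in msupp f -> (m i < B)%N.
  move=> /msize_mdeg_lt; apply: leq_ltn_trans.
  by rewrite mdegE (bigD1 i) //= leq_addr.
have w_inj m m' : m \in msupp f -> m' \in msupp f -> w m = w m' -> m = m'.
  move=> mf m'f e; apply/mnmP.
  by apply: (base_digits_inj _ _ e) => i; apply: digit.
have mmapXw m : mmap1 (fun i : 'I_n => 'X^(B ^ i) : {poly k}) m = 'X^(w m).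
  rewrite /mmap1 /w; elim/big_ind2: _ => [|_ x _ y -> ->|i _].
  - by rewrite expr0.
  - by rewrite exprD.
  - by rewrite -exprM mulnC.
have m0f : mlead f \in msupp f by apply: mlead_supp.
apply/eqP => /(congr1 (fun p : {poly k} => p`_(w (mlead f)))).
rewrite coef0 /mmap coef_sum (bigD1_seq _ m0f) ?msupp_uniq //=.
rewrite mmapXw coefCM coefXn eqxx mulr1 big_seq_cond big1 => [|m].
  by rewrite addr0; apply/eqP; rewrite mleadc_eq0.
case/andP=> mf nm; rewrite mmapXw coefCM coefXn; case: eqP => [e|]; last by rewrite mulr0.
by rewrite (w_inj _ _ m0f mf e) eqxx in nm.
Qed.

(* The dimension is the size of a companion matrix of ['X^b * g - 1], where
   both [b = 1] and [b = 2] make [g] act invertibly. *)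
Lemma exists_matrix_unit (g : {poly k}) : g != 0 ->
  exists (m : nat) (T : 'M[k]_m.+1),
    m.+1%:R != 0 :> k /\ exists U, horner_mx T g *m U = 1%:M.
Proof.
move=> g0; pose h := (lead_coef g)^-1 *: g.
have lg0 : lead_coef g != 0 by rewrite lead_coef_eq0.
have h_monic : h \is monic by rewrite monicE lead_coefZ mulVf.
(* If [deg h + 1] is zero in [k], then [deg h + 2] is one. *)
have [b [b0 dim0]] : exists b, (0 < b)%N /\ ((size h).-1 + b)%:R != 0 :> k.
  have [e|ne] := eqVneq ((size h).-1 + 1)%:R (0 : k); last by exists 1%N.
  by exists 2; split=> //; rewrite (addnA _ 1%N 1%N) natrD e add0r oner_neq0.
pose p := h * 'X^b - 1.
have sz_h : (0 < size h)%N by rewrite lt0n size_poly_eq0 monic_neq0.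
have sz_hX : size (h * 'X^b) = (size h + b)%N.
  by rewrite size_Mmonic ?monicXn ?monic_neq0 // size_polyXn addnS.
have sz1 : (size (- 1 : {poly k})%R < size (h * 'X^b)%R)%N.
  by rewrite size_polyN size_poly1 sz_hX -(prednK sz_h) addSn ltnS addn_gt0 b0 orbT.
have sz_p : size p = ((size h).-1 + b).+1%N.
  by rewrite /p size_polyDl // sz_hX -addSn prednK.
have p_monic : p \is monic.
  by rewrite monicE lead_coefDl ?lead_coef_Mmonic ?monicXn ?(monicP h_monic).
have [m mE] : exists m, (size p).-1 = m.+1.
  by exists ((size h).-1 + b).-1; rewrite sz_p prednK // addn_gt0 b0 orbT.
have [T charT] : exists T : 'M[k]_m.+1, char_poly T = p.
  by rewrite -mE; exists (companionmx p); apply: companionmxK.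
exists m, T; split; first by rewrite -mE sz_p.
(* By Cayley-Hamilton [T] is a root of [h * 'X^b - 1], where [h] is [g] divided by its leading
   coefficient. *)
exists (horner_mx T ('X^b * (lead_coef g)^-1%:P)).
have -> : forall X Y : 'M[k]_m.+1, X *m Y = X * Y by [].
rewrite -rmorphM mulrA -mulrAC [g * _]mulrC mul_polyC -/h.
have : horner_mx T p = 0 by rewrite -charT Cayley_Hamilton.
by rewrite rmorphB rmorph1 => /eqP; rewrite subr_eq0 => /eqP.
Qed.

(** Over a finite field [f] may vanish at every rational point. A point with values in the
    polynomials in one matrix [T] avoids this, and the size of [T] can be kept nonzero in [k] for
    the trace argument. *)
Lemma exists_matrix_point (f : {mpoly k[n]}) : f != 0 ->
  exists (m : nat) (al : {rmorphism {mpoly k[n]} -> 'M[k]_m.+1}),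
    [/\ m.+1%:R != 0 :> k, forall c, al c%:MP = c%:M
      & exists U, al f *m U = 1%:M].
Proof.
move=> /mmap_neq0 [q /exists_matrix_unit [m [T [m0 [U fU]]]]].
exists m, (horner_mx T \o mmap polyC q); split=> // [c|]; last by exists U.
by rewrite /= mmapC horner_mx_C.
Qed.

End MatrixPoint.

(** * Representations by polynomial matrices *)

Section MatrixRepresentations.
Variables (A : comNzRingType) (Lm : pzRingType) (n : nat).
Definition matrix_rep (rho : {rmorphism Lm -> 'M[A]_n.+1}) (V : lmodType A) :
    Type :=
  {ffun 'I_n.+1 -> V}.

HB.instance Definition _ rho V := GRing.Zmodule.on (matrix_rep rho V).

Variable rho : {rmorphism Lm -> 'M[A]_n.+1}.
Local Notation rep := (matrix_rep rho).

Section RepModule.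
Variable V : lmodType A.

(** The entry at [(s, t)] moves the component at [s] to the one at [t], as a path from [s] to [t]
    does on a right module; so the matrix acts on row vectors. *)
Definition rep_scale (a : Lm^c) (v : rep V) : rep V :=
  [ffun t => \sum_s rho a s t *: v s].

Lemma rep_scale_val a v t : rep_scale a v t = \sum_s rho a s t *: v s.
Proof. exact: ffunE. Qed.

Lemma rep_add_val (v w : rep V) t : (v + w) t = v t + w t.
Proof. exact: ffunE. Qed.

Lemma rep_scaleA a b v : rep_scale a (rep_scale b v) = rep_scale (a * b) v.
Proof.
apply/ffunP => t; rewrite [LHS]rep_scale_val [RHS]rep_scale_val.
have -> : rho (a * b) = rho b *m rho a by apply: rmorphM.
under [RHS]eq_bigr do rewrite mxE scaler_suml.
rewrite exchange_big /=; apply: eq_bigr => s _.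
rewrite rep_scale_val scaler_sumr.
by apply: eq_bigr => u _; rewrite scalerA mulrC.
Qed.

Lemma rep_scale1 : left_id 1 rep_scale.
Proof.
move=> v; apply/ffunP => t; rewrite rep_scale_val.
have -> : rho (1 : Lm^c) = 1%:M by apply: rmorph1.
rewrite (bigD1 t) //= mxE eqxx scale1r big1 ?addr0 // => s /negbTE ns.
by rewrite mxE ns scale0r.
Qed.

Lemma rep_scaleDr : right_distributive rep_scale +%R.
Proof.
move=> a v w; apply/ffunP => t; rewrite [RHS]rep_add_val !rep_scale_val -big_split.
by apply: eq_bigr => s _; rewrite (rep_add_val v w s) scalerDr.
Qed.

Lemma rep_scaleDl v : {morph rep_scale^~ v : a b / a + b}.
Proof.
move=> a b; apply/ffunP => t; rewrite [RHS]rep_add_val !rep_scale_val -big_split.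
by apply: eq_bigr => s _; rewrite [rho _](rmorphD rho) mxE scalerDl.
Qed.

HB.instance Definition _ := GRing.Zmodule_isLmodule.Build Lm^c (rep V)
  rep_scaleA rep_scale1 rep_scaleDr rep_scaleDl.

Lemma rep_scaleE (a : Lm^c) (v : rep V) t :
  (a *: v) t = \sum_s rho a s t *: v s.
Proof. exact: rep_scale_val. Qed.

Lemma rep_addE (v w : rep V) t : (v + w) t = v t + w t.
Proof. exact: ffunE. Qed.

Lemma rep_sumE (I : finType) (F : I -> rep V) t : (\sum_i F i) t = \sum_i F i t.
Proof. exact: sum_ffunE. Qed.

End RepModule.

Section RepMap.
Variables (V W : lmodType A) (p : {linear V -> W}).

Definition rep_map_fun (v : rep V) : rep W := [ffun t => p (v t)].

Lemma rep_map_val v t : rep_map_fun v t = p (v t).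
Proof. exact: ffunE. Qed.

Lemma rep_map_is_linear (a : Lm^c) v w :
  rep_map_fun (a *: v + w) = a *: rep_map_fun v + rep_map_fun w.
Proof.
apply/ffunP => t.
rewrite [LHS]rep_map_val; apply: etrans (congr1 p (rep_addE (a *: v) w t)) _.
rewrite linearD [RHS]rep_addE [in RHS]rep_map_val.
rewrite (rep_scaleE a v t) (rep_scaleE a (rep_map_fun v) t); congr (_ + _).
by rewrite linear_sum; apply: eq_bigr => s _; rewrite linearZ rep_map_val.
Qed.

Definition rep_map : {linear rep V -> rep W} := mk_linear rep_map_is_linear.

Lemma rep_mapE v t : rep_map v t = p (v t).
Proof. exact: rep_map_val. Qed.

End RepMap.

End MatrixRepresentations.

Arguments rep_map {A Lm n} rho {V W} p.

(** * Extending a multiplicative map on paths to the path algebra *)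

Section PathAlgebraLift.
Variables (k : fieldType) (Q : quiver) (S : nzRingType).
Variables (f : {rmorphism k -> S}) (h : qpath Q -> S).

Definition path_lift (x : path_alg k Q) : S :=
  @monalg.mmap (qpath Q) k S f h x.

Lemma path_liftE x :
  path_lift x = \sum_(p <- monalg.msupp x) f (monalg.mcoeff p x) * h p.
Proof. by []. Qed.

Lemma path_lift_is_zmod_morphism : zmod_morphism path_lift.
Proof. exact: (@monalg.mmapB (qpath Q) k S f h). Qed.

HB.instance Definition _ := GRing.isZmodMorphism.Build (path_alg k Q) S path_lift
  path_lift_is_zmod_morphism.

Lemma path_liftZ c (x : path_alg k Q) : path_lift (c *: x) = f c * path_lift x.
Proof.
have le : fsubset (monalg.msupp (c *: x : path_alg k Q)) (monalg.msupp x).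
  exact: monalg.msuppZ_le.
rewrite /path_lift (monalg.mmapEw le) big_distrr /=.
by apply: eq_bigr => p _; rewrite monalg.mcoeffZ rmorphM mulrA.
Qed.

Lemma path_lift_of_path p : path_lift (of_path k p) = h p.
Proof. by rewrite /path_lift of_path.unlock monalg.mmapU /= rmorph1 mul1r. Qed.

Hypothesis f_central : forall c x, f c * x = x * f c.
Hypothesis h_cat : forall p q,
  h p * h q = if pcat p q is Some r then h r else 0.

Lemma path_liftM (x y : path_alg k Q) :
  path_lift (x * y) = path_lift x * path_lift y.
Proof.
have -> : x * y = path_mul x y by [].
rewrite path_mul.unlock raddf_sum /= (path_liftE x) big_distrl /=.
apply: eq_bigr => p _; rewrite raddf_sum /= (path_liftE y) big_distrr /=.
apply: eq_bigr => q _.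
rewrite path_liftZ rmorphM -!mulrA; congr (_ * _).
rewrite f_central [f _ * h q]f_central mulrA; congr (_ * _).
by rewrite h_cat /pmul; case: pcat => [r|]; [apply: path_lift_of_path | apply: raddf0].
Qed.

End PathAlgebraLift.

(** * The matrix representation of [Lambda] over the polynomial ring *)

Section Representations.
Variables (k : fieldType) (n : nat).

Local Notation A := {mpoly k[n]}.
Local Notation Q := (Lambda_quiver n).
Local Notation L := (Lambda k n).

(* Dehomogenization at the first variable. *)
Definition affine_var (a : 'I_n.+1) : A :=
  if unlift ord0 a is Some j then 'X_j else 1.

Lemma affine_var0 : affine_var ord0 = 1.
Proof. by rewrite /affine_var unlift_none. Qed.

Lemma affine_varS j : affine_var (lift ord0 j) = 'X_j.
Proof. by rewrite /affine_var liftK. Qed.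

Definition path_mx (p : qpath Q) : 'M[A]_n.+1 :=
  (\prod_(e <- parrows p) affine_var e.2) *: delta_mx (psrc p) (ptgt p).

Lemma path_mx_cat p q :
  path_mx p * path_mx q = if pcat p q is Some r then path_mx r else 0.
Proof.
rewrite /path_mx -scalerAl -scalerAr scalerA -[delta_mx _ _ * _]/(_ *m _).
rewrite mul_delta_mx_cond; case: pcatP => [r e1 e2 e3 e4|/negbTE ->].
  by rewrite e1 eqxx e2 e3 e4 big_cat.
by rewrite mulr0n scaler0.
Qed.

Definition scalar_A : {rmorphism k -> 'M[A]_n.+1} := scalar_mx \o @mpolyC n k.

Lemma scalar_A_central c (x : 'M[A]_n.+1) : scalar_A c * x = x * scalar_A c.
Proof. by rewrite -[LHS]/(_%:M *m x) -[RHS]/(x *m _%:M) scalar_mxC. Qed.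

Definition path_rep (x : path_alg k Q) : 'M[A]_n.+1 :=
  path_lift scalar_A path_mx x.

Lemma path_repB x y : path_rep (x - y) = path_rep x - path_rep y.
Proof. exact: raddfB. Qed.

Lemma path_repM x y : path_rep (x * y) = path_rep x * path_rep y.
Proof. exact: path_liftM scalar_A_central path_mx_cat x y. Qed.

Lemma path_rep1 : path_rep 1 = 1.
Proof.
rewrite -[1]/(path_one k Q) /path_one /path_rep raddf_sum /=.
under eq_bigr => v _.
  rewrite path_lift_of_path /path_mx big_nil scale1r; over.
rewrite [RHS](_ : _ = 1%:M) //; apply/matrixP => i j.
rewrite summxE mxE (bigD1 i) //= mxE eqxx /= eq_sym big1 ?addr0 // => v /negbTE nv.
by rewrite mxE [i == _]eq_sym nv.
Qed.

Definition arrow_mx (a : 'I_n.+1) (i : 'I_n) : 'M[A]_n.+1 :=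
  affine_var a *: delta_mx (widen_ord (leqnSn n) i) (lift ord0 i).

Lemma path_rep_xarrow a i : path_rep (xarrow k a i) = arrow_mx a i.
Proof. by rewrite /path_rep path_lift_of_path /path_mx big_seq1. Qed.

(** The two paths in a relation give the same product of matrix units, and their variables commute
    in [A]. *)
Lemma path_rep_ideal x : x \in ideal_gen (@Lambda_rel k n) -> path_rep x = 0.
Proof.
move=> /asboolP/(_ (fun x => path_rep x = 0)); apply.
  split=> [|u v u0 v0|a u u0|a u u0].
  - exact: raddf0.
  - by rewrite path_repB u0 v0 subr0.
  - by rewrite path_repM u0 mulr0.
  - by rewrite path_repM u0 mul0r.
move=> _ [i [j [a [b [_ ->]]]]].
rewrite path_repB !path_repM !path_rep_xarrow /arrow_mx.
by rewrite -!scalerAl -!scalerAr !scalerA mulrC subrr.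
Qed.

Definition rep_mx (x : L) : 'M[A]_n.+1 := path_rep (quot_repr x).

Lemma rep_mx_pi x : rep_mx (Lambda_pi x) = path_rep x.
Proof.
apply/eqP; rewrite eq_sym -subr_eq0 -path_repB; apply/eqP/path_rep_ideal.
exact: quot_pi_repr.
Qed.

Lemma rep_mxM x y : rep_mx (x * y) = rep_mx x * rep_mx y.
Proof.
have [[u ->] [v ->]] := (Lambda_pi_surj x, Lambda_pi_surj y).
by rewrite -Lambda_pi_mul !rep_mx_pi path_repM.
Qed.

Lemma rep_mx1 : rep_mx 1 = 1.
Proof. by rewrite -[1]/(Lambda_pi 1) rep_mx_pi path_rep1. Qed.

Lemma rep_mxZ c x : rep_mx (c *: x) = c%:MP *: rep_mx x.
Proof.
have [u ->] := Lambda_pi_surj x.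
rewrite -Lambda_pi_scale !rep_mx_pi /path_rep path_liftZ.
by rewrite -[_ * _]/(_%:M *m _) mul_scalar_mx.
Qed.

Lemma rep_mx_is_zmod_morphism : zmod_morphism rep_mx.
Proof.
move=> x y; have [[u ->] [v ->]] := (Lambda_pi_surj x, Lambda_pi_surj y).
rewrite !rep_mx_pi -path_repB -rep_mx_pi; congr rep_mx.
by apply: (addIr (Lambda_pi v)); rewrite subrK /Lambda_pi -quot_piD subrK.
Qed.

HB.instance Definition _ := GRing.isZmodMorphism.Build L 'M[A]_n.+1 rep_mx
  rep_mx_is_zmod_morphism.

HB.instance Definition _ := GRing.isMonoidMorphism.Build L 'M[A]_n.+1 rep_mx
  (rep_mx1, rep_mxM).

End Representations.

(** * Lifting homomorphisms from [M] away from a hypersurface *)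

Section GenericLifting.
Variables (A : idomainType) (Lm : pzRingType) (n : nat).
Variable rho : {rmorphism Lm -> 'M[A]_n.+1}.
Variables (M : rmodType Lm).

(* Over the localization at [f] the relations of [M] have constant rank. *)
Lemma rep_hom_lift : fin_gen M ->
  exists2 f : A, f != 0 & forall (V W : lmodType A) (p : {linear V -> W}),
    surjective p -> (exists h : W -> W, forall w, f *: h w = w /\ h (f *: w) = w) ->
    forall phi : {linear M -> matrix_rep rho W}, exists psi : {linear M -> matrix_rep rho V},
      forall x, rep_map rho p (psi x) = phi x.
Proof.
move=> [q [g genM]]; pose I := ('I_q * 'I_n.+1)%type.
pose rel_row (a : 'I_q -> Lm) t : 'rV[A]_#|{: I}| :=
  \row_l rho (a (enum_val l).1) (enum_val l).2 t.
have row_sum (V : lmodType A) (y : 'I_q -> matrix_rep rho V) (a : 'I_q -> Lm^c) t :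
    (\sum_i a i *: y i) t =
    \sum_l rel_row a t 0 l *: y (enum_val l).1 (enum_val l).2.
  rewrite rep_sumE (eq_bigr _ (fun i _ => rep_scaleE (a i) (y i) t)) pair_big /=.
  rewrite (reindex (@enum_val I predT)) /=; last exact/onW_bij/enum_val_bij.
  by apply: eq_bigr => l _; rewrite mxE.
(* A relation of [M], read at the vertex [t], is a linear equation over [A] on the components of the
   images of the generators. *)
pose Rel v := exists (a : 'I_q -> Lm^c) t, \sum_i a i *: g i = 0 /\ v = rel_row a t.
have [f f0 [m [D [Psi [RelD RelPsi]]]]] := generic_kernel Rel.
exists f => // V W p p_surj [h hP] phi.
have f_inj (w : W) : f *: w = 0 -> w = 0.
  by move=> /(congr1 h); rewrite (hP w).2 -{1}(scaler0 _ f) (hP 0).2.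
pose w (l : 'I_#|{: I}|) : W := h (phi (g (enum_val l).1) (enum_val l).2).
have Rel_w v : Rel v -> \sum_l v 0 l *: w l = 0.
  move=> [a [t [ag0 ->]]]; apply: f_inj; rewrite scaler_sumr.
  have : phi (\sum_i a i *: g i) t = 0 by rewrite ag0 linear0 ffunE.
  rewrite linear_sum (eq_bigr _ (fun i _ => linearZ _ _)) row_sum => e; rewrite -[RHS]e.
  by apply: eq_bigr => l _; rewrite scalerA mulrC -scalerA (hP _).1.
have [u uE] := choice (fun l => p_surj (w l)).
pose PD := Psi *m D.
(* The [u l] lift the values of [phi] divided by [f], but need not satisfy the relations. Applying
   [f - Psi D] repairs this, as [v (f - Psi D) = 0] for every [v] in [Rel]. The projection of [z] is
   still the value of [phi], because the rows of [D] are relations and kill [w]. *)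
pose z l : V := f *: u l - \sum_l' PD l l' *: u l'.
have pz l : p (z l) = phi (g (enum_val l).1) (enum_val l).2.
  rewrite linearB linearZ /= uE (hP _).1 linear_sum /=.
  under eq_bigr do rewrite linearZ /= uE mxE scaler_suml.
  rewrite exchange_big big1 ?subr0 //= => r _.
  under eq_bigr do rewrite -scalerA.
  rewrite -scaler_sumr (_ : \sum_l' _ = \sum_l' row r D 0 l' *: w l').
    by rewrite Rel_w ?scaler0.
  by apply: eq_bigr => l' _; rewrite mxE.
have Rel_z v : Rel v -> \sum_l v 0 l *: z l = 0.
  move=> Rv; have e := RelPsi v Rv; rewrite -mulmxA -/PD in e.
  under eq_bigr do rewrite scalerBr scaler_sumr.
  rewrite sumrB exchange_big /= -sumrB big1 // => l' _.
  rewrite (eq_bigr _ (fun i _ => scalerA _ _ _)) -scaler_suml scalerA -scalerBl.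
  have /rowP/(_ l') := e; rewrite !mxE mulrC => ->.
  by rewrite subrr scale0r.
pose y i : matrix_rep rho V := [ffun s => z (enum_rank ((i, s) : I))].
have yE l : y (enum_val l).1 (enum_val l).2 = z l.
  by rewrite ffunE -surjective_pairing enum_valK.
have [|psi psiE] := linear_of_gens (y := y) genM.
  move=> a ag0; apply/ffunP => t; rewrite row_sum ffunE.
  under eq_bigr do rewrite yE.
  by apply: Rel_z; exists a, t.
exists psi => x; have [a ->] := genM x.
rewrite !linear_sum; apply: eq_bigr => i _; rewrite !linearZ /=; congr (_ *: _).
apply/ffunP => s; rewrite rep_mapE psiE ffunE pz.
by rewrite enum_rankK.
Qed.

End GenericLifting.

(** * Ghost maps over the endomorphism ring *)

Section HomGhosts.
Variables (Lm : pzRingType) (M : rmodType Lm).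

(** The components of a surjection from a power of [M] onto the regular module, evaluated at a
    preimage of 1. *)
Lemma generates_trace : generates M ->
  exists (r : nat) (p : 'I_r -> {linear M -> (Lm^c)^o}) (m : 'I_r -> M),
    \sum_i p i (m i) = 1.
Proof.
move=> genM; have [|r [f f_surj]] := genM (Lm^c)^o.
  by exists 1%N, (fun=> 1) => x; exists (fun=> x); rewrite big_ord1 [RHS]mulr1.
have [w fw] := f_surj 1.
pose single i (x : M) : {ffun 'I_r -> M} := [ffun j => if j == i then x else 0].
have singleL i a u v : single i (a *: u + v) = a *: single i u + single i v.
  by apply/ffunP => j; rewrite !ffunE; case: eqP; rewrite ?scaler0 ?addr0.
exists r, (fun i => f \o mk_linear (singleL i)), w; rewrite -[RHS]fw.
rewrite -linear_sum /=; congr (f _); apply/ffunP => j; rewrite sum_ffunE.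
rewrite (bigD1 j) //= ffunE eqxx big1 ?addr0 // => i nij.
by rewrite ffunE eq_sym (negbTE nij).
Qed.

Lemma hom_of_subproof (p : {linear M -> (Lm^c)^o}) (Y : rmodType Lm) (y : Y)
    (a : Lm^c) u v :
  (p (a *: u + v) : Lm^c) *: y = a *: ((p u : Lm^c) *: y) + (p v : Lm^c) *: y.
Proof. by rewrite linearP scalerDl scalerA. Qed.

(** The composite of [p] with the map from the regular module to [Y] that sends 1 to [y]. *)
Definition hom_of p (Y : rmodType Lm) (y : Y) : {linear M -> Y} :=
  mk_linear (hom_of_subproof p y).

Lemma hom_ofE p (Y : rmodType Lm) (y : Y) x : hom_of p y x = (p x : Lm^c) *: y.
Proof. by []. Qed.

Lemma end_sumE (I : finType) (F : I -> end_ring M) (x : M) :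
  (\sum_i F i : {linear M -> M}) x = \sum_i (F i : {linear M -> M}) x.
Proof. by apply: (big_morph (fun f : end_ring M => (f : {linear M -> M}) x)). Qed.

Variables (n : nat) (Y : rmodType Lm) (F : 'I_n -> rmodType Lm).
Variables (iota : forall i, {linear Y -> F i}) (pi : forall i, {linear F i -> Y}).
Hypothesis iota_inj : forall i, injective (iota i).
Hypothesis iota_pi : forall i, exact (iota i) (pi i).
Hypothesis hom_lift : forall i (phi : {linear M -> Y}),
  exists psi : {linear M -> F i}, forall x, pi i (psi x) = phi x.
Variables (T : finType) (d : T -> T -> Lm).
Hypothesis d_sqr : forall s t, \sum_u d s u * d u t = 0.
Variables (c : nat -> T -> Y) (b : forall i, T -> F i).
Hypothesis pi_b : forall (i : 'I_n) t, pi i (b i t) = c i t.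
Hypothesis b_d : forall (i : 'I_n) t,
  \sum_s (d s t : Lm^c) *: b i s = iota i (c i.+1 t).

(* As [M] generates, [Hom(M, -)] turns the complex of free modules with
   differential [d] into a direct summand of a complex of free modules over
   [End M]. *)
Lemma pdim_hom_ghost (e : nat) : generates M -> (e < n)%N ->
  pdim_le (hom_mod M Y) e ->
  exists s : T -> Y, forall t, c n t = \sum_u (d u t : Lm^c) *: s u.
Proof.
move=> /generates_trace [r [p [m pm]]] lt_en pdY.
pose R := ('I_r * T)%type.
pose D (l j : R) : end_ring M := hom_of (p j.1) ((d l.2 j.2 : Lm^c) *: m l.1).
pose cM i (j : R) : hom_mod M Y := hom_of (p j.1) (c i j.2).
pose bM i (j : R) : hom_mod M (F i) := hom_of (p j.1) (b i j.2).
(* Since the [p i (m i)] add up to 1, [D] acts on cochains of the form [hom_of] as [d] acts on their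
   values. *)
have mulDE (V : rmodType Lm) (v : T -> V) (j : R) (x : M) :
    (mulD D (fun l : R => hom_of (p l.1) (v l.2) : hom_mod M V) j) x =
    (p j.1 x : Lm^c) *: \sum_u (d u j.2 : Lm^c) *: v u.
  rewrite hom_sumE -(pair_bigA _ (fun k u => hom_of (p k) (v u) (D (k, u) j x))) /=.
  rewrite exchange_big scaler_sumr /=; apply: eq_bigr => u _.
  under eq_bigr do rewrite linearZ /=.
  have pE : \sum_i (p j.1 x : Lm^c) *: p i ((d u j.2 : Lm^c) *: m i) =
      (p j.1 x : Lm^c) *: ((d u j.2 : Lm^c) *: (1 : (Lm^c)^o)).
    rewrite -pm !scaler_sumr; apply: eq_bigr => i _.
    by rewrite linearZ.
  rewrite -scaler_suml scalerA; congr (_ *: _); apply: etrans pE _.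
  by rewrite -[LHS]/(_ * (_ * 1)) mulr1.
have D_sqr l j : \sum_i D l i * D i j = 0.
  apply: end_ringP => x; rewrite end_sumE.
  have := mulDE M (fun u => (d l.2 u : Lm^c) *: m l.1) j x.
  rewrite hom_sumE => e1; apply: etrans e1 _.
  under eq_bigr do rewrite scalerA.
  rewrite -scaler_suml; set q := (X in _ *: (X *: _)).
  by have -> : q = 0; [apply: (d_sqr l.2 j.2) | rewrite scale0r scaler0].
have [|||||s sE] := @pdim_ghost _ (hom_mod M Y) n (fun i => hom_mod M (F i))
    (fun i => hom_map M (iota i)) (fun i => hom_map M (pi i)) _ _ _ _ D D_sqr cM bM
    _ _ e lt_en pdY.
- move=> i f g fg; apply: hom_modP => x; apply: (@iota_inj i).
  by rewrite -[LHS]hom_mapE -[RHS]hom_mapE fg.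
- move=> i g; split=> [pg|[f <-]]; last first.
    by apply: hom_modP => x; rewrite !hom_mapE; apply/iota_pi; exists (f x).
  have gI x : exists u, iota i u = g x.
    by apply/iota_pi; rewrite -hom_mapE pg.
  have [f fE] := linear_factor (@iota_inj i) gI.
  by exists f; apply: hom_modP => x; rewrite hom_mapE fE.
- move=> i g; have [f fE] := hom_lift i g.
  by exists f; apply: hom_modP => x; rewrite hom_mapE fE.
- by move=> i j; apply: hom_modP => x; rewrite hom_mapE !hom_ofE linearZ /= pi_b.
- move=> i j; apply: hom_modP => x; rewrite mulDE hom_mapE hom_ofE.
  by rewrite b_d linearZ.
(* Evaluating at the [m k] and summing is the retraction onto the summand: it takes [hom_of] back to
   its value and commutes with the differentials. *)
exists (fun u => \sum_k s (k, u) (m k)) => t.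
have -> : c n t = \sum_j cM n (j, t) (m j).
  under eq_bigr do rewrite hom_ofE /=.
  rewrite -scaler_suml; set q := (X in X *: _).
  by have -> : q = 1 by []; rewrite scale1r.
under eq_bigr do rewrite sE hom_sumE.
rewrite exchange_big /=.
transitivity (\sum_k \sum_u \sum_j s (k, u) ((p j (m j) : Lm^c) *: ((d u t : Lm^c) *: m k))).
  by rewrite [RHS]pair_bigA; apply: eq_bigr => -[k u] _.
rewrite exchange_big; apply: eq_bigr => u _; rewrite scaler_sumr.
apply: eq_bigr => k _; rewrite -linear_sum -linearZ; congr (s (k, u) _).
rewrite -scaler_suml; set q := (X in X *: _).
by have -> : q = 1 by []; rewrite scale1r.
Qed.

End HomGhosts.

(** * The Koszul differential *)

Section Koszul.
Variables (k : fieldType) (R : algType k) (n m : nat).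
Variables (x : 'I_n -> R) (x0 : R) (a : 'I_n -> 'M[k]_m).
Hypothesis xC : forall i j, x i * x j = x j * x i.
Hypothesis x0C : forall i, x0 * x i = x i * x0.
Hypothesis aC : forall i j, a i *m a j = a j *m a i.

Definition koszul_index : finType := ({set 'I_n} * 'I_m)%type.

(** Counting the elements above [j] gives sign 1 to the removal of the largest element of [J], the
    case that matters for initial segments. *)
Definition koszul_sign (j : 'I_n) (J : {set 'I_n}) : k :=
  (-1) ^+ #|[set l in J | (j < l)%N]|.

(* The matrix of [x j - a j x0]. *)
Definition koszul_entry j (u w : 'I_m) : R :=
  (u == w)%:R *: x j - a j u w *: x0.

(** All degrees of the Koszul complex are taken together; a basis element indexed by [t] maps to
    those whose set is that of [t] with one element removed. *)
Definition koszul_diff (s t : koszul_index) : R :=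
  \sum_(j in t.1 | s.1 == t.1 :\ j)
    koszul_sign j t.1 *: koszul_entry j s.2 t.2.

Definition koszul_entry2 i j u w : R :=
  \sum_y koszul_entry i u y * koszul_entry j y w.

Lemma koszul_entry2C i j u w : koszul_entry2 i j u w = koszul_entry2 j i u w.
Proof.
have sumE p q : koszul_entry2 p q u w =
    (u == w)%:R *: (x p * x q) - a q u w *: (x p * x0)
    - (a p u w *: (x0 * x q) - (a p *m a q) u w *: (x0 * x0)).
  rewrite /koszul_entry2 /koszul_entry.
  under eq_bigr do rewrite mulrBl !mulrBr -!scalerAl -!scalerAr !scalerA.
  rewrite !sumrB -!scaler_suml mxE.
  have delta (F : 'I_m -> k) : \sum_y (u == y)%:R * F y = F u.
    rewrite (bigD1 u) //= eqxx mul1r big1 ?addr0 // => y /negbTE nyu.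
    by rewrite eq_sym nyu mul0r.
  have delta' (F : 'I_m -> k) : \sum_y F y * (y == w)%:R = F w.
    rewrite (bigD1 w) //= eqxx mulr1 big1 ?addr0 // => y /negbTE nyw.
    by rewrite nyw mulr0.
  by rewrite !delta !delta'.
rewrite !sumE xC aC !x0C !opprB !addrA [LHS]addrAC [RHS]addrAC.
by congr (_ + _); apply: addrAC.
Qed.

Lemma sum_antisymmetric (V : zmodType) (F : 'I_n -> 'I_n -> V) :
  (forall i, F i i = 0) -> (forall i j : 'I_n, (i < j)%N -> F i j = - F j i) ->
  \sum_i \sum_j F i j = 0.
Proof.
move=> F0 FN.
have splitF i : \sum_j F i j =
    \sum_(j : 'I_n | (i < j)%N) F i j + \sum_(j : 'I_n | (j < i)%N) F i j.
  rewrite (bigID (fun j : 'I_n => (i < j)%N)) /=; congr (_ + _).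
  rewrite (bigD1 i) ?ltnn //= F0 add0r; apply: eq_bigl => j.
  by rewrite -leqNgt ltn_neqAle andbC.
under eq_bigr do rewrite splitF.
rewrite big_split /= [X in _ + X](exchange_big_dep predT) //= -big_split big1 //= => i _.
by rewrite -big_split big1 //= => j ij; rewrite FN // addNr.
Qed.

Lemma koszul_signN (i j : 'I_n) (J : {set 'I_n}) : (i < j)%N -> j \in J ->
  koszul_sign i (J :\ j) = - koszul_sign i J.
Proof.
move=> ij jJ; rewrite /koszul_sign.
have -> : [set l in J | (i < l)%N] = j |: [set l in J :\ j | (i < l)%N].
  apply/setP => l; rewrite !inE; case: eqVneq => [->|//] /=.
  by rewrite jJ ij.
by rewrite cardsU1 !inE eqxx exprS mulN1r opprK.
Qed.

Lemma koszul_sign_id (i j : 'I_n) (J : {set 'I_n}) : (i < j)%N ->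
  koszul_sign j (J :\ i) = koszul_sign j J.
Proof.
move=> ij; rewrite /koszul_sign; congr (_ ^+ #|pred_of_set _|).
apply/setP => l; rewrite !inE; case: (eqVneq l i) => [->|//] /=.
by rewrite ltnNge (ltnW ij) andbF.
Qed.

(** Removing two elements in either order gives the same product of matrices with opposite signs. In
    the proof, [H i j] collects the terms that remove [j] first and then [i]. *)
Lemma koszul_diff_sqr s t : \sum_u koszul_diff s u * koszul_diff u t = 0.
Proof.
case: s t => [I u] [J w].
pose H i j := if [&& j \in J, i \in J :\ j & I == J :\ j :\ i]
  then (koszul_sign i (J :\ j) * koszul_sign j J) *: koszul_entry2 i j u w else 0.
transitivity (\sum_i \sum_j H i j); last first.
  apply: sum_antisymmetric => [i|i j ij].
    by rewrite /H !inE eqxx andbF.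
  rewrite /H !inE (koszul_entry2C i j).
  have [nij nji] : i != j /\ j != i by rewrite neq_ltn ij eq_sym neq_ltn ij.
  rewrite nij nji /=; have -> : J :\ i :\ j = J :\ j :\ i.
    by apply/setP => l; rewrite !inE andbCA.
  case jJ: (j \in J); case iJ: (i \in J); rewrite ?oppr0 //=.
  case: eqP => _; rewrite ?oppr0 // koszul_signN // koszul_sign_id //.
  by rewrite mulNr scaleNr mulrC.
rewrite exchange_big /=.
rewrite -(pair_bigA _ (fun K y => koszul_diff (I, u) (K, y) * koszul_diff (K, y) (J, w))) /=.
have term K y : koszul_diff (I, u) (K, y) * koszul_diff (K, y) (J, w) =
    \sum_j \sum_i (if [&& j \in J, K == J :\ j, i \in K & I == K :\ i]
      then (koszul_sign i K * koszul_sign j J) *: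
        (koszul_entry i u y * koszul_entry j y w) else 0).
  rewrite /koszul_diff /= big_distrr /= big_mkcond; apply: eq_bigr => j _.
  case: (j \in J) => /=; last by rewrite big1.
  case: eqP => _ /=; last by rewrite big1.
  rewrite big_distrl /= big_mkcond; apply: eq_bigr => i _.
  by case: ifP => // _; rewrite -scalerAl -scalerAr scalerA.
under eq_bigr do under eq_bigr do rewrite term.
under eq_bigr do rewrite exchange_big.
rewrite exchange_big /=; apply: eq_bigr => j _.
under eq_bigr do rewrite exchange_big.
rewrite exchange_big /=; apply: eq_bigr => i _.
rewrite (bigD1 (J :\ j)) //= [X in _ + X]big1 ?addr0; last first.
  by move=> K /negbTE nK; rewrite big1 // => y _; rewrite nK andbF.
rewrite eqxx /= /H; case: ifP => _; last by rewrite big1.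
by rewrite -scaler_sumr.
Qed.

End Koszul.

Lemma koszul_diff_mx (k : fieldType) (R : algType k) (A : comNzRingType)
    (iota : k -> A) (N n m : nat) (rho : {additive R -> 'M[A]_N})
    (rhoZ : forall c r, rho (c *: r) = iota c *: rho r)
    (x : 'I_n -> R) (x0 : R) (a : 'I_n -> 'M[k]_m) s t p q :
  rho (koszul_diff x x0 a s t) p q =
  \sum_(j in t.1 | s.1 == t.1 :\ j) iota (koszul_sign k j t.1) *
    (iota (s.2 == t.2)%:R * rho (x j) p q - iota (a j s.2 t.2) * rho x0 p q).
Proof.
rewrite raddf_sum /= summxE; apply: eq_bigr => j _.
by rewrite rhoZ mxE; congr (_ * _); rewrite raddfB /= !rhoZ !mxE.
Qed.

(** * The Koszul differential on matrix representations *)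

Section KoszulAction.
Variables (k : fieldType) (n : nat) (R : algType k).

Local Notation A := {mpoly k[n]}.

Variable rho : {rmorphism R -> 'M[A]_n.+1}.
Hypothesis rhoZ : forall c r, rho (c *: r) = c%:MP *: rho r.
Variable x : 'I_n.+1 -> R.
Hypothesis rho_x : forall a (p : 'I_n.+1) (i : 'I_n), rho (x a) p (lift ord0 i) =
  if p == widen_ord (leqnSn n) i then affine_var k a else 0.
Hypothesis rho_x0 : forall a (p : 'I_n.+1), rho (x a) p ord0 = 0.
Variables (m : nat) (a : 'I_n -> 'M[k]_m).

Local Notation kd := (koszul_diff (fun j => x (lift ord0 j)) (x ord0) a).

Let rep_kd s t p q : rho (kd s t) p q =
  \sum_(j in t.1 | s.1 == t.1 :\ j) (koszul_sign k j t.1)%:MP *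
    (((s.2 == t.2)%:R)%:MP * rho (x (lift ord0 j)) p q -
     (a j s.2 t.2)%:MP * rho (x ord0) p q).
Proof. exact: (koszul_diff_mx (iota := @mpolyC n k)). Qed.

Variable V : lmodType A.
Implicit Types y : koszul_index n m -> matrix_rep rho V.

Lemma koszul_diff_act0 y t :
  (\sum_s (kd s t : R^c) *: y s) ord0 = 0.
Proof.
rewrite rep_sumE big1 // => s _; rewrite rep_scaleE big1 // => p _.
rewrite [X in X *: _](_ : _ = 0) ?scale0r //.
apply: etrans (rep_kd _ _ _ _) _.
by rewrite big1 // => j _; rewrite !rho_x0 !mulr0 subr0 mulr0.
Qed.

(** The homogeneous [x j - a j x0] raises the vertex by one, and since [x0] becomes 1 on the chart
    it acts there as ['X_j - a j]. *)
Lemma koszul_diff_act y (J : {set 'I_n}) w (i : 'I_n) :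
  (\sum_s (kd s (J, w) : R^c) *: y s) (lift ord0 i) =
  \sum_(j in J) (koszul_sign k j J)%:MP *:
    ('X_j *: y (J :\ j, w) (widen_ord (leqnSn n) i) -
     \sum_u (a j u w)%:MP *: y (J :\ j, u) (widen_ord (leqnSn n) i)).
Proof.
pose z (s : koszul_index n m) : V := y s (widen_ord (leqnSn n) i).
pose e j u : A := (koszul_sign k j J)%:MP * (((u == w)%:R)%:MP * 'X_j - (a j u w)%:MP).
rewrite rep_sumE.
transitivity (\sum_s (\sum_(j in J | s.1 == J :\ j) e j s.2) *: z s).
  apply: eq_bigr => s _; rewrite rep_scaleE (bigD1 (widen_ord (leqnSn n) i)) //=.
  rewrite big1 ?addr0 => [|p /negbTE np].
    congr (_ *: _); apply: etrans (rep_kd _ _ _ _) _.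
    by apply: eq_bigr => j _; rewrite !rho_x eqxx affine_varS affine_var0 mulr1.
  rewrite [X in X *: _](_ : _ = 0) ?scale0r //.
  apply: etrans (rep_kd _ _ _ _) _.
  by rewrite big1 // => j _; rewrite !rho_x np !mulr0 subr0 mulr0.
transitivity (\sum_I \sum_u \sum_(j in J) (if I == J :\ j then e j u *: z (I, u) else 0)).
  rewrite [RHS]pair_bigA; apply: eq_bigr => -[I u] _ /=.
  by rewrite scaler_suml -big_mkcondr.
under eq_bigr do rewrite exchange_big.
rewrite exchange_big; apply: eq_bigr => j _ /=.
rewrite (bigD1 (J :\ j)) //= [X in _ + X]big1 ?addr0; last first.
  by move=> I /negbTE nI; rewrite big1 // => u _; rewrite nI.
under eq_bigr do rewrite eqxx /= /e -scalerA.
rewrite -scaler_sumr; congr (_ *: _).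
transitivity (\sum_u (((u == w)%:R%:MP * 'X_j : A) *: z (J :\ j, u) -
    (a j u w)%:MP *: z (J :\ j, u))).
  by apply: eq_bigr => u _; rewrite -scalerBl.
rewrite sumrB (bigD1 w) //= eqxx mul1r big1 ?addr0 // => u /negbTE nuw.
by rewrite nuw mul0r scale0r.
Qed.

End KoszulAction.

(** * Commuting variables inside [Lambda] *)

Section LambdaVariables.
Variables (k : fieldType) (n : nat).

Local Notation L := (Lambda k n).

Definition lvar (a : 'I_n.+1) : L := \sum_(i < n) Lambda_pi (xarrow k a i).

(** Only consecutive arrows have a nonzero product, and for those the commutation is a defining
    relation. *)
Lemma lvarC a b : lvar a * lvar b = lvar b * lvar a.
Proof.
rewrite /lvar !mulr_suml; apply: eq_bigr => i _.
rewrite !mulr_sumr; apply: eq_bigr => j _.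
rewrite -!Lambda_pi_mul; have [eij|nij] := eqVneq (j : nat) i.+1.
  by apply/quot_piP/mem_ideal_gen; exists i, j, a, b.
have x0 c d : xarrow k c i * xarrow k d j = 0.
  rewrite [LHS]path_mulUU /pmul /pcat; case: eqP => // /(congr1 val) /= e.
  by move: nij; rewrite -e eqxx.
by rewrite !x0.
Qed.

Lemma rep_lvar a (p : 'I_n.+1) (i : 'I_n) :
  rep_mx (lvar a) p (lift ord0 i) =
  if p == widen_ord (leqnSn n) i then affine_var k a else 0.
Proof.
rewrite raddf_sum /= summxE.
rewrite (eq_bigr (fun j => arrow_mx k a j p (lift ord0 i))); last first.
  by move=> j _; rewrite rep_mx_pi path_rep_xarrow.
rewrite (bigD1 i) //= !mxE eqxx andbT big1 ?addr0 => [|j /negbTE nji].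
  by case: eqP; rewrite ?mulr1 ?mulr0.
by rewrite !mxE (inj_eq (@lift_inj _ ord0)) [i == j]eq_sym nji andbF mulr0.
Qed.

Lemma rep_lvar0 a (p : 'I_n.+1) : rep_mx (lvar a) p ord0 = 0.
Proof.
rewrite raddf_sum /= summxE big1 // => j _.
by rewrite rep_mx_pi path_rep_xarrow !mxE andbF mulr0.
Qed.

End LambdaVariables.

(** * Modules at a point *)

Section PointModule.
Variables (A : nzRingType) (k : fieldType) (m : nat).

Definition point_mod (al : {rmorphism A -> 'M[k]_m.+1}) : Type := 'cV[k]_m.+1.

HB.instance Definition _ al := GRing.Zmodule.on (point_mod al).

Variable al : {rmorphism A -> 'M[k]_m.+1}.

Definition point_scale (h : A) (v : point_mod al) : point_mod al := al h *m v.

Lemma point_scaleA g h v : point_scale g (point_scale h v) = point_scale (g * h) v.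
Proof. by rewrite /point_scale mulmxA rmorphM. Qed.

Lemma point_scale1 : left_id 1 point_scale.
Proof. by move=> v; rewrite /point_scale rmorph1 mul1mx. Qed.

Lemma point_scaleDr : right_distributive point_scale +%R.
Proof. by move=> h u v; apply: mulmxDr. Qed.

Lemma point_scaleDl v : {morph point_scale^~ v : g h / g + h}.
Proof. by move=> g h; rewrite /point_scale rmorphD; apply: mulmxDl. Qed.

HB.instance Definition _ := GRing.Zmodule_isLmodule.Build A (point_mod al)
  point_scaleA point_scale1 point_scaleDr point_scaleDl.

Lemma point_scaleE h (v : point_mod al) : h *: v = al h *m v.
Proof. by []. Qed.

End PointModule.

(** * First-order deformations in a coordinate direction *)

Section TangentModule.
Variables (k : fieldType) (n : nat) (i : 'I_n).
Local Notation A := {mpoly k[n]}.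
Variable V : lmodType A.

(* [V[eps] / eps^2], with [h] acting as [h + eps dh/dx_i]. *)
Definition tangent_mod (j : 'I_n) (W : lmodType A) : Type := (W * W)%type.

HB.instance Definition _ j W := GRing.Zmodule.on (tangent_mod j W).

Local Notation E := (tangent_mod i V).

Definition tangent_scale (h : A) (v : E) : E :=
  (h *: v.1, h *: v.2 + h^`M(i) *: v.1).

Lemma tangent_scaleA g h v :
  tangent_scale g (tangent_scale h v) = tangent_scale (g * h) v.
Proof.
rewrite /tangent_scale /= scalerA; congr pair.
rewrite mderivM scalerDr scalerDl !scalerA -addrA; congr (_ + _).
exact: addrC.
Qed.

Lemma tangent_scale1 : left_id 1 tangent_scale.
Proof.
move=> [u v]; rewrite /tangent_scale /= !scale1r.
by rewrite -mpolyC1 mderivC scale0r addr0.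
Qed.

Lemma tangent_scaleDr : right_distributive tangent_scale +%R.
Proof.
move=> h u v; rewrite /tangent_scale /= !scalerDr; congr pair.
by rewrite addrACA.
Qed.

Lemma tangent_scaleDl v : {morph tangent_scale^~ v : g h / g + h}.
Proof.
move=> g h; rewrite /tangent_scale /= mderivD !scalerDl; congr pair.
by rewrite addrACA.
Qed.

HB.instance Definition _ := GRing.Zmodule_isLmodule.Build A E
  tangent_scaleA tangent_scale1 tangent_scaleDr tangent_scaleDl.

Lemma tangent_scaleE h (v : E) : h *: v = (h *: v.1, h *: v.2 + h^`M(i) *: v.1).
Proof. by []. Qed.

Definition tangent_inj_fun (v : V) : E := (0, v).

Lemma tangent_inj_is_linear h u v :
  tangent_inj_fun (h *: u + v) = h *: tangent_inj_fun u + tangent_inj_fun v.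
Proof.
rewrite tangent_scaleE /= !scaler0 addr0.
by rewrite /tangent_inj_fun -[RHS]/(0 + 0, _ + _) addr0.
Qed.

Definition tangent_inj : {linear V -> E} := mk_linear tangent_inj_is_linear.

Lemma tangent_proj_is_linear (h : A) (u v : E) :
  (h *: u + v).1 = h *: u.1 + v.1.
Proof. by []. Qed.

Definition tangent_proj : {linear E -> V} := mk_linear tangent_proj_is_linear.

End TangentModule.

(** Commutators have trace zero, while the identity has trace [m]. *)
Lemma sum_commutators_neq1 (k : fieldType) (m n : nat)
    (e : 'I_n -> k) (a S : 'I_n -> 'M[k]_m) : m%:R != 0 :> k ->
  \sum_j e j *: (a j *m S j - S j *m a j) != 1%:M.
Proof.
apply: contraNneq => /(congr1 mxtrace); rewrite mxtrace1 => <-.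
rewrite raddf_sum big1 //= => j _.
by rewrite mxtraceZ raddfB /= mxtrace_mulC subrr mulr0.
Qed.

(** * The lower bound *)

Section GlobalDimension.
Variables (k : fieldType) (n : nat) (R : algType k).
Hypothesis n_gt0 : (0 < n)%N.

Local Notation A := {mpoly k[n]}.

Variable rho : {rmorphism R -> 'M[A]_n.+1}.
Hypothesis rhoZ : forall c r, rho (c *: r) = c%:MP *: rho r.
Variable x : 'I_n.+1 -> R.
Hypothesis xC : forall a b, x a * x b = x b * x a.
Hypothesis rho_x : forall a (p : 'I_n.+1) (i : 'I_n), rho (x a) p (lift ord0 i) =
  if p == widen_ord (leqnSn n) i then affine_var k a else 0.
Hypothesis rho_x0 : forall a (p : 'I_n.+1), rho (x a) p ord0 = 0.

(** * The tangent extensions and their product at one point *)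

Section Point.
Variables (m : nat) (al : {rmorphism A -> 'M[k]_m.+1}).
Hypothesis alC : forall c, al c%:MP = c%:M.
Hypothesis m_neq0 : m.+1%:R != 0 :> k.

Local Notation C := (point_mod al).
Local Notation Y := (matrix_rep rho C).
Local Notation F i := (matrix_rep rho (tangent_mod i C)).
Local Notation T := (koszul_index n m.+1).

Let a (j : 'I_n) : 'M[k]_m.+1 := al 'X_j.
Let kd := koszul_diff (fun j : 'I_n => x (lift ord0 j)) (x ord0) a.

Let kd_sqr s t : \sum_u kd s u * kd u t = 0.
Proof. by apply: koszul_diff_sqr => // i j; rewrite -[LHS]rmorphM mulrC rmorphM. Qed.

Let initial (i : nat) : {set 'I_n} := [set l : 'I_n | (l < i)%N].

Let e (u : 'I_m.+1) : C := delta_mx u 0 : 'cV[k]_m.+1.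

(** The identity of [C], placed at the vertex [i] and at the exterior basis element of the first [i]
    indices. Thus [c n] sits at the last vertex and the full set. *)
Let c (i : nat) (t : T) : Y :=
  [ffun p : 'I_n.+1 => if (p == i :> nat) && (t.1 == initial i) then e t.2 else 0].

Let b (i : 'I_n) (t : T) : F i :=
  [ffun p : 'I_n.+1 => if (p == i :> nat) && (t.1 == initial i) then (e t.2, 0) else 0].

Let iota (i : 'I_n) : {linear Y -> F i} := rep_map rho (tangent_inj i C).
Let pi (i : 'I_n) : {linear F i -> Y} := rep_map rho (tangent_proj i C).

Let sum_col (B : 'M[k]_m.+1) w : \sum_u B u w *: (e u : 'cV_m.+1) = B *m (e w : 'cV_m.+1).
Proof.
rewrite -colE; apply/colP => p; rewrite summxE (bigD1 p) //= !mxE !eqxx mulr1.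
by rewrite big1 ?addr0 // => u /negbTE nup; rewrite !mxE eq_sym nup mulr0.
Qed.

(** On [C] the variable ['X_j] acts as [a j], so the first component cancels; what is left is the
    derivative of ['X_j] in direction [i]. *)
Let tangent_term (i j : 'I_n) (w : 'I_m.+1) :
  'X_j *: ((e w, 0) : tangent_mod i C) -
    \sum_u (a j u w)%:MP *: ((e u, 0) : tangent_mod i C) =
  (0, if j == i then e w else 0).
Proof.
pose z (v : C) : tangent_mod i C := (v, 0).
have zD u v : z (u + v) = z u + z v by rewrite -[RHS]/(u + v, 0 + 0) addr0.
have -> : \sum_u (a j u w)%:MP *: ((e u, 0) : tangent_mod i C) = z ('X_j *: e w).
  rewrite point_scaleE -sum_col (big_morph z zD erefl); apply: eq_bigr => u _.
  rewrite tangent_scaleE /= scaler0 add0r mderivC scale0r point_scaleE alC.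
  by rewrite mul_scalar_mx.
rewrite tangent_scaleE /= scaler0 add0r mderivX mnm1E -[LHS]/(_ - _, _ - _) /=.
rewrite subrr subr0; congr pair; case: eqP => [->|_]; last by rewrite !scale0r.
by rewrite (_ : U_(i) - U_(i) = 0)%MM ?mpolyX0 ?scale1r //; apply/mnmP => l; rewrite mnmBE subnn mnm0E.
Qed.

Let pi_b (i : 'I_n) t : pi i (b i t) = c i t.
Proof.
apply/ffunP => p; rewrite /pi rep_mapE !ffunE.
by case: ifP.
Qed.

(** By [tangent_term] only the removal of [i] contributes. It must leave [initial i], which forces
    the set [initial i.+1], and its sign is 1 since no element exceeds [i]. *)
Let b_kd (i : 'I_n) t : \sum_s (kd s t : R^c) *: b i s = iota i (c i.+1 t).
Proof.
case: t => J w; apply/ffunP => q; rewrite /iota rep_mapE.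
case: (unliftP ord0 q) => [l ->|->]; last first.
  by rewrite (koszul_diff_act0 rhoZ rho_x0) ffunE.
rewrite (koszul_diff_act rhoZ rho_x) [c _ _ _]ffunE /=.
have initS : (J == initial i.+1) = (i \in J) && (J :\ i == initial i).
  apply/eqP/andP => [->|[iJ /eqP Ji]].
    rewrite inE ltnS leqnn; split=> //; apply/eqP/setP => l'.
    by rewrite !inE ltnS [in RHS]ltn_neqAle.
  apply/setP => l'; have /setP/(_ l') := Ji; rewrite !inE ltnS.
  by have [->|nl] := eqVneq l' i; rewrite ?iJ ?leqnn //= => ->; rewrite ltn_neqAle nl.
pose v : tangent_mod i C := (0, e w).
have term j : j \in J -> (koszul_sign k j J)%:MP *:
    ('X_j *: b i (J :\ j, w) (widen_ord (leqnSn n) l) -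
     \sum_u (a j u w)%:MP *: b i (J :\ j, u) (widen_ord (leqnSn n) l)) =
    if [&& l == i, J :\ j == initial i & j == i] then v else 0.
  move=> jJ; have bE u : b i (J :\ j, u) (widen_ord (leqnSn n) l) =
      if (l == i) && (J :\ j == initial i) then (e u, 0) else 0 by rewrite ffunE.
  rewrite bE; under eq_bigr do rewrite bE.
  case: eqP => [_|_] /=; last first.
    by rewrite scaler0 big1 ?subr0 ?scaler0 // => u _; rewrite scaler0.
  case: eqP => [Jj|_] /=; last first.
    by rewrite scaler0 big1 ?subr0 ?scaler0 // => u _; rewrite scaler0.
  rewrite tangent_term; case: eqP => [ji|_]; last exact: scaler0.
  rewrite ji in Jj *; rewrite /koszul_sign (_ : [set l' in J | (i < l')%N] = set0).
    by rewrite cards0 expr0 mpolyC1 scale1r.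
  apply/setP => l'; rewrite !inE; apply/negP => /andP [l'J il'].
  have /setP/(_ l') := Jj; rewrite !inE l'J andbT ltnNge (ltnW il') /=.
  by rewrite neq_ltn il' orbT.
rewrite (eq_bigr _ term) eqSS -[(l == i :> nat)]/(l == i) initS.
case: (l == i) => /=; last by rewrite big1.
have [iJ|niJ] := boolP (i \in J) => /=; last first.
  rewrite big1 // => j jJ; case: (j =P i) => [ji|]; last by rewrite andbF.
  by rewrite -ji jJ in niJ.
rewrite (bigD1 i) //= eqxx andbT big1 ?addr0 => [|j /andP [_ /negbTE ->]].
  by case: ifP.
by rewrite andbF.
Qed.

Let iota_inj i : injective (iota i).
Proof.
move=> v w e1; apply/ffunP => p.
by have /ffunP/(_ p) := e1; rewrite !rep_mapE => -[].
Qed.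

Let iota_pi i : exact (iota i) (pi i).
Proof.
move=> v; split=> [pv|[u <-]]; last first.
  by apply/ffunP => p; rewrite /pi /iota !rep_mapE [RHS]ffunE.
exists [ffun p => (v p).2]; apply/ffunP => p; rewrite rep_mapE ffunE /=.
have /ffunP/(_ p) := pv; rewrite /pi rep_mapE [RHS]ffunE /= => v1.
by rewrite [RHS]surjective_pairing v1.
Qed.

Lemma pdim_point (M : rmodType R) (d : nat) : generates M ->
  (forall i (phi : {linear M -> Y}), exists psi : {linear M -> F i},
     forall z, rep_map rho (tangent_proj i C) (psi z) = phi z) ->
  pdim_le (hom_mod M Y) d -> (n <= d)%N.
Proof.
move=> genM liftF pdY; rewrite leqNgt; apply/negP => lt_dn.
have [s sE] := pdim_hom_ghost iota_inj iota_pi liftF kd_sqr pi_b b_kd genM lt_dn pdY.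
have lt_n : (n.-1 < n)%N by rewrite prednK.
(* The last arrow position: [lift ord0 q] is the vertex [n], where [c n] lives, and the coboundary
   there reads [s] at the vertex [n - 1]. *)
pose q : 'I_n := Ordinal lt_n.
pose S j : 'M[k]_m.+1 := \matrix_(p, u)
  ((s ([set: 'I_n] :\ j, u) (widen_ord (leqnSn n) q) : 'cV[k]_m.+1) p 0).
have /eqP := sum_commutators_neq1 (fun j => koszul_sign k j setT) a S m_neq0; apply.
have cE w : c n (setT, w) (lift ord0 q) = e w.
  rewrite ffunE /= /bump leq0n add1n prednK // eqxx /=.
  by rewrite (_ : setT = initial n) ?eqxx //; apply/setP => l; rewrite !inE ltn_ord.
pose z j u : C := s ([set: 'I_n] :\ j, u) (widen_ord (leqnSn n) q).
(* Column [w] of the commutator identity: ['X_j] acts as [a j] on column [w] of [S j], and the inner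
   sum is column [w] of [S j *m a j]. *)
have eE w : e w = \sum_j (koszul_sign k j setT)%:MP *:
    ('X_j *: z j w - \sum_u (a j u w)%:MP *: z j u).
  rewrite -cE sE (koszul_diff_act rhoZ rho_x).
  by apply: eq_bigl => j; rewrite inE.
apply/matrixP => p w; rewrite summxE.
transitivity ((e w : 'cV[k]_m.+1) p 0); last by rewrite !mxE andbT.
rewrite eE [RHS]summxE; apply: eq_bigr => j _.
rewrite [RHS](_ : _ = (koszul_sign k j setT *:
  (a j *m z j w - \sum_u a j u w *: (z j u : 'cV[k]_m.+1))) p 0).
  rewrite !mxE summxE; congr (_ * (_ - _)); apply: eq_bigr => u _.
    by rewrite !mxE.
  by rewrite !mxE mulrC.
congr (fun_of_matrix _ p 0); rewrite point_scaleE alC mul_scalar_mx.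
congr (_ *: (_ - _)); apply: eq_bigr => u _.
by rewrite point_scaleE alC mul_scalar_mx.
Qed.

End Point.

Lemma gldim_end_generator (M : rmodType R) : fin_gen M -> generates M ->
  le_enat (Fin n) (gldim (end_ring M)).
Proof.
move=> fgM genM; apply/enat_minP => d pdM.
have [f f0 lift] := @rep_hom_lift A R n rho M fgM.
(* At this point [f] acts invertibly on [C], so every homomorphism from [M] lifts along all the
   tangent projections. *)
have [m [al [m0 alC [U fU]]]] := exists_matrix_point f0.
have pdY := pdM (hom_mod M (matrix_rep rho (point_mod al))).
suff : le_enat (Fin n) (pdim (hom_mod M (matrix_rep rho (point_mod al)))).
  by case: (pdim _) pdY => //= p pd np; apply: leq_trans np pd.
apply/enat_minP => d' /(pdim_point alC m0 genM); apply => i; apply: lift.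
  by move=> v; exists (v, 0).
exists (fun v => U *m v) => v; rewrite !point_scaleE.
by rewrite !mulmxA fU (mulmx1C fU) !mul1mx.
Qed.

End GlobalDimension.

Theorem mainTheorem1 (k : fieldType) (n : nat) (hn : (1 <= n)%N) :
  (forall M : rmodType (Lambda k n),
      fin_gen M -> generates M -> le_enat (Fin n) (gldim (end_ring M)))
  /\ le_enat (Fin n) (repdim (Lambda k n)).
Proof.
have main : forall M : rmodType (Lambda k n),
    fin_gen M -> generates M -> le_enat (Fin n) (gldim (end_ring M)).
  exact: (@gldim_end_generator k n (Lambda k n) hn (@rep_mx k n) (@rep_mxZ k n)
    (@lvar k n) (@lvarC k n) (@rep_lvar k n) (@rep_lvar0 k n)).
split=> //; apply/enat_minP => d [M [fgM genM _ gldimM]].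
by have := main M fgM genM; rewrite gldimM.
Qed.
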